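(* Let $S=\langle K,\overline{K},\Gamma\cup\{\infty\},v,\mathrm{ac}\rangle$ be an $\mathcal{L}_{RRP}$-structure with $\mathrm{char}\,K=0$, $\mathrm{char}\,\overline{K}=0$, $v$ a valuation map with value group $\Gamma$ and residue field $\overline{K}$, $\mathrm{ac}$ an angular component map, $\Gamma$ a $\mathbb{Z}$-group, and $\mathrm{Th}(S)$ admitting quantifier elimination in the $K$-sort. Then there is an $\mathcal{L}_{RRP}$-structure $S_1=\langle K_1,\overline{K}_1,\Gamma_1\cup\{\infty\},v_1,\mathrm{ac}_1\rangle$ with $S_1\equiv S$ and $v_1$ of rank $1$.
   Context: $\mathcal{L}_{RRP}$ is three-sorted: the $K$-sort (main sort) and $\overline{K}$-sort with the ring language $\{+,-,\cdot,0,1\}$, the $\Gamma$-sort with $\{+,<,0,1\}\cup\{D_n:n>1\}\cup\{\infty\}$ ($D_n$ divisibility by $n$, $\infty$ a top element), and function symbols $v:K\to\Gamma\cup\{\infty\}$, $\mathrm{ac}:K\to\overline{K}$. A $\mathbb{Z}$-group is an ordered abelian group elementarily equivalent to $(\mathbb{Z},+,<,0,1,D_n)_{n>1}$. An angular component map satisfies $\mathrm{ac}\,0=0$, restricts to a group homomorphism $K^\times\to\overline{K}^\times$, and $\mathrm{ac}\,u=u+\mathcal{M}$ for units $u$. Quantifier elimination in the $K$-sort means every formula is equivalent modulo $\mathrm{Th}(S)$ to one without $K$-sort quantifiers. A valuation has rank $1$ if its value group is nontrivial with no convex subgroups besides $\{0\}$ and itself. *)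

(* Defs.v *)
From mathcomp Require Import all_boot all_order all_algebra.

Set Implicit Arguments.
Unset Strict Implicit.
Unset Printing Implicit Defensive.

Import Order.TTheory GRing.Theory Num.Theory.
Local Open Scope ring_scope.

(* Variables are de Bruijn indices, numbered independently for each sort; an
   assignment of the variables of a sort is a function on nat. *)
Definition push (T : Type) (a : T) (e : nat -> T) (i : nat) : T :=
  if i is j.+1 then e j else a.

(* porderZmodType neither relates the order to the addition nor requires it
   to be total. *)
Definition ordered_group (G : porderZmodType) : Prop :=
  (forall x y : G, (x <= y) || (y <= x)) /\
  (forall x y z : G, x <= y -> x + z <= y + z).

(* The one-sorted language {+, <, 0, 1} with D_n for n > 1: the Gamma-sort
   without oo, for comparison with Z. *)
Inductive pterm : Type :=
  | PVar of nat
  | PZero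
  | POne
  | PAdd of pterm & pterm.

(* [PDiv n t] is D_(n+2) t, so that n : nat enumerates the symbols D_n, n > 1 *)
Inductive pformula : Type :=
  | PEq of pterm & pterm
  | PLt of pterm & pterm
  | PDiv of nat & pterm
  | PNot of pformula
  | PAnd of pformula & pformula
  | PEx of pformula.

Section PresburgerSemantics.
Variables (G : porderZmodType) (one : G).

Fixpoint peval (e : nat -> G) (t : pterm) : G :=
  match t with
  | PVar i => e i
  | PZero => 0
  | POne => one
  | PAdd t u => peval e t + peval e u
  end.

Fixpoint psat (e : nat -> G) (f : pformula) : Prop :=
  match f with
  | PEq t u => peval e t = peval e u
  | PLt t u => peval e t < peval e u
  | PDiv n t => exists y : G, peval e t = y *+ n.+2
  | PNot f => ~ psat e f
  | PAnd f g => psat e f /\ psat e g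
  | PEx f => exists a : G, psat (push a e) f
  end.

End PresburgerSemantics.

Fixpoint pterm_below (n : nat) (t : pterm) : bool :=
  match t with
  | PVar i => (i < n)%N
  | PZero | POne => true
  | PAdd t u => pterm_below n t && pterm_below n u
  end.

Fixpoint pformula_below (n : nat) (f : pformula) : bool :=
  match f with
  | PEq t u | PLt t u => pterm_below n t && pterm_below n u
  | PDiv _ t => pterm_below n t
  | PNot f => pformula_below n f
  | PAnd f g => pformula_below n f && pformula_below n g
  | PEx f => pformula_below n.+1 f
  end.

Definition ptrue (G : porderZmodType) (one : G) (f : pformula) : Prop :=
  forall e : nat -> G, psat one e f.

Definition Z_group (G : porderZmodType) (one : G) : Prop :=
  ordered_group G /\
  (forall f : pformula, pformula_below 0 f ->
     (ptrue one f <-> ptrue (1 : int) f)).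

Inductive Kterm : Type :=
  | KVar of nat
  | KZero
  | KOne
  | KAdd of Kterm & Kterm
  | KSub of Kterm & Kterm
  | KMul of Kterm & Kterm.

Inductive Rterm : Type :=
  | RVar of nat
  | RZero
  | ROne
  | RAdd of Rterm & Rterm
  | RSub of Rterm & Rterm
  | RMul of Rterm & Rterm
  | RAc of Kterm.

Inductive Gterm : Type :=
  | GVar of nat
  | GZero
  | GOne
  | GInf
  | GAdd of Gterm & Gterm
  | GVal of Kterm.

(* As above, [FDiv n t] is D_(n+2) t. *)
Inductive formula : Type :=
  | FEqK of Kterm & Kterm
  | FEqR of Rterm & Rterm
  | FEqG of Gterm & Gterm
  | FLt of Gterm & Gterm
  | FDiv of nat & Gterm
  | FNot of formula
  | FAnd of formula & formula
  | FExK of formula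
  | FExR of formula
  | FExG of formula.

(* Structures for L_RRP in the sense of model theory: arbitrary
   interpretations of the three sorts and of the symbols.  [sG] is the whole
   third sort, including the interpretation [sinfG] of the constant oo, and
   [sdivG n] interprets D_(n+2). *)
Record structure : Type := Structure {
  sK : Type;
  sR : Type;
  sG : Type;
  s0K : sK; s1K : sK;
  saddK : sK -> sK -> sK; ssubK : sK -> sK -> sK; smulK : sK -> sK -> sK;
  s0R : sR; s1R : sR;
  saddR : sR -> sR -> sR; ssubR : sR -> sR -> sR; smulR : sR -> sR -> sR;
  s0G : sG; s1G : sG; sinfG : sG;
  saddG : sG -> sG -> sG;
  sltG : sG -> sG -> Prop;
  sdivG : nat -> sG -> Prop;
  sval : sK -> sG;
  sac : sK -> sR
}.

Section Semantics.
Variable M : structure.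

Fixpoint Keval (eK : nat -> sK M) (t : Kterm) : sK M :=
  match t with
  | KVar i => eK i
  | KZero => s0K M
  | KOne => s1K M
  | KAdd t u => saddK (Keval eK t) (Keval eK u)
  | KSub t u => ssubK (Keval eK t) (Keval eK u)
  | KMul t u => smulK (Keval eK t) (Keval eK u)
  end.

Fixpoint Reval (eK : nat -> sK M) (eR : nat -> sR M) (t : Rterm) : sR M :=
  match t with
  | RVar i => eR i
  | RZero => s0R M
  | ROne => s1R M
  | RAdd t u => saddR (Reval eK eR t) (Reval eK eR u)
  | RSub t u => ssubR (Reval eK eR t) (Reval eK eR u)
  | RMul t u => smulR (Reval eK eR t) (Reval eK eR u)
  | RAc t => sac (Keval eK t)
  end.

Fixpoint Geval (eK : nat -> sK M) (eG : nat -> sG M) (t : Gterm) : sG M :=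
  match t with
  | GVar i => eG i
  | GZero => s0G M
  | GOne => s1G M
  | GInf => sinfG M
  | GAdd t u => saddG (Geval eK eG t) (Geval eK eG u)
  | GVal t => sval (Keval eK t)
  end.

Fixpoint sat (eK : nat -> sK M) (eR : nat -> sR M) (eG : nat -> sG M)
    (f : formula) : Prop :=
  match f with
  | FEqK t u => Keval eK t = Keval eK u
  | FEqR t u => Reval eK eR t = Reval eK eR u
  | FEqG t u => Geval eK eG t = Geval eK eG u
  | FLt t u => sltG (Geval eK eG t) (Geval eK eG u)
  | FDiv n t => sdivG n (Geval eK eG t)
  | FNot f => ~ sat eK eR eG f
  | FAnd f g => sat eK eR eG f /\ sat eK eR eG g
  | FExK f => exists a : sK M, sat (push a eK) eR eG f
  | FExR f => exists a : sR M, sat eK (push a eR) eG f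
  | FExG f => exists a : sG M, sat eK eR (push a eG) f
  end.

Definition holds (f : formula) : Prop := forall eK eR eG, sat eK eR eG f.

End Semantics.

Fixpoint Kterm_below (k : nat) (t : Kterm) : bool :=
  match t with
  | KVar i => (i < k)%N
  | KZero | KOne => true
  | KAdd t u | KSub t u | KMul t u => Kterm_below k t && Kterm_below k u
  end.

Fixpoint Rterm_below (k r : nat) (t : Rterm) : bool :=
  match t with
  | RVar i => (i < r)%N
  | RZero | ROne => true
  | RAdd t u | RSub t u | RMul t u => Rterm_below k r t && Rterm_below k r u
  | RAc t => Kterm_below k t
  end.

Fixpoint Gterm_below (k g : nat) (t : Gterm) : bool :=
  match t with
  | GVar i => (i < g)%N
  | GZero | GOne | GInf => true
  | GAdd t u => Gterm_below k g t && Gterm_below k g u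
  | GVal t => Kterm_below k t
  end.

(* All free variables of [f] of the three sorts are below k, r and g. *)
Fixpoint formula_below (k r g : nat) (f : formula) : bool :=
  match f with
  | FEqK t u => Kterm_below k t && Kterm_below k u
  | FEqR t u => Rterm_below k r t && Rterm_below k r u
  | FEqG t u | FLt t u => Gterm_below k g t && Gterm_below k g u
  | FDiv _ t => Gterm_below k g t
  | FNot f => formula_below k r g f
  | FAnd f h => formula_below k r g f && formula_below k r g h
  | FExK f => formula_below k.+1 r g f
  | FExR f => formula_below k r.+1 g f
  | FExG f => formula_below k r g.+1 f
  end.

Definition sentence (f : formula) : bool := formula_below 0 0 0 f.

Definition Th (M : structure) (f : formula) : Prop := sentence f /\ holds M f.

Definition elem_equiv (M N : structure) : Prop :=
  forall f : formula, sentence f -> (holds M f <-> holds N f).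

Definition models (T : formula -> Prop) (M : structure) : Prop :=
  forall f : formula, T f -> holds M f.

Definition equiv_mod (T : formula -> Prop) (f g : formula) : Prop :=
  forall M : structure, models T M ->
  forall eK eR eG, @sat M eK eR eG f <-> @sat M eK eR eG g.

Fixpoint K_quantifier_free (f : formula) : bool :=
  match f with
  | FEqK _ _ | FEqR _ _ | FEqG _ _ | FLt _ _ | FDiv _ _ => true
  | FNot f | FExR f | FExG f => K_quantifier_free f
  | FAnd f g => K_quantifier_free f && K_quantifier_free g
  | FExK _ => false
  end.

Definition K_quantifier_elimination (T : formula -> Prop) : Prop :=
  forall f : formula, exists g : formula,
    K_quantifier_free g /\ equiv_mod T f g.

(* G with a top element oo is [option G], where [None] is oo. *)
Section Infinity.
Variable G : porderZmodType.
Implicit Types x y : option G.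

Definition add_oo x y : option G :=
  match x, y with Some a, Some b => Some (a + b) | _, _ => None end.

Definition lt_oo x y : bool :=
  match x, y with
  | Some a, Some b => a < b
  | Some _, None => true
  | None, _ => false
  end.

Definition le_oo x y : bool :=
  match x, y with
  | Some a, Some b => a <= b
  | _, None => true
  | None, Some _ => false
  end.

Definition min_oo x y : option G := if lt_oo x y then x else y.

(* oo = n oo is divisible by every n *)
Definition div_oo (n : nat) x : Prop :=
  if x is Some a then exists b : G, a = b *+ n else True.

End Infinity.

Record vf_data : Type := VFData {
  vfK : fieldType;
  vfR : fieldType;
  vfG : porderZmodType;
  vf1 : vfG;
  vfv : vfK -> option vfG;
  vfac : vfK -> vfR
}.

Definition vf_structure (S : vf_data) : structure := {|
  sK := vfK S; sR := vfR S; sG := option (vfG S);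
  s0K := 0; s1K := 1;
  saddK := fun x y => x + y;
  ssubK := fun x y => x - y;
  smulK := fun x y => x * y;
  s0R := 0; s1R := 1;
  saddR := fun x y => x + y;
  ssubR := fun x y => x - y;
  smulR := fun x y => x * y;
  s0G := Some 0; s1G := Some (vf1 S); sinfG := None;
  saddG := @add_oo (vfG S);
  sltG := fun x y => lt_oo x y;
  sdivG := fun n x => div_oo n.+2 x;
  sval := @vfv S;
  sac := @vfac S
|}.

Coercion vf_structure : vf_data >-> structure.

Section ValuedFields.
Variables (K R : fieldType) (G : porderZmodType).

(* The last clause makes G the value group. *)
Definition is_valuation (v : K -> option G) : Prop :=
  [/\ ordered_group G,
      forall x : K, v x = None <-> x = 0,
      forall x y : K, v (x * y) = add_oo (v x) (v y),
      forall x y : K, le_oo (min_oo (v x) (v y)) (v (x + y))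
    & forall g : G, exists x : K, v x = Some g].

(* [res], restricted to the valuation ring O of v, is a surjective ring
   morphism O -> R whose kernel is the maximal ideal M, so that it identifies
   R with O/M and [res u] with u + M.  Its values outside O are irrelevant. *)
Definition is_residue_map (v : K -> option G) (res : K -> R) : Prop :=
  let O x := le_oo (Some 0) (v x) in
  let M x := lt_oo (Some 0) (v x) in
  [/\ res 1 = 1,
      forall x y : K, O x -> O y -> res (x + y) = res x + res y,
      forall x y : K, O x -> O y -> res (x * y) = res x * res y,
      forall x : K, O x -> (res x = 0 <-> M x)
    & forall a : R, exists x : K, O x /\ res x = a].

Definition is_angular_component (v : K -> option G) (res ac : K -> R) : Prop :=
  [/\ ac 0 = 0,
      forall x : K, x != 0 -> ac x != 0,
      forall x y : K, x != 0 -> y != 0 -> ac (x * y) = ac x * ac y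
    & forall u : K, v u = Some 0 -> ac u = res u].

End ValuedFields.

Definition ac_valued_field (S : vf_data) : Prop :=
  is_valuation (@vfv S) /\
  exists res : vfK S -> vfR S,
    is_residue_map (@vfv S) res /\
    is_angular_component (@vfv S) res (@vfac S).

Definition convex_subgroup (G : porderZmodType) (A : G -> Prop) : Prop :=
  [/\ A 0,
      forall x y : G, A x -> A y -> A (x - y)
    & forall x y z : G, A x -> A z -> x <= y <= z -> A y].

Definition rank_one (S : vf_data) : Prop :=
  (exists g : vfG S, g != 0) /\
  forall A : vfG S -> Prop, convex_subgroup A ->
    (forall g, A g <-> g = 0) \/ (forall g, A g).

(* Main.v *)
Require Import Defs.
From HB Require Import structures.
From mathcomp Require Import all_boot all_order all_algebra.
From mathcomp Require Import boolp.

(* S_1 is obtained by omitting the type {x > n.1 : n} of a nonstandard element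
   of the Gamma-sort; its value group is then Z, which has rank 1.  The type
   can be omitted: by K-quantifier elimination a formula phi(x) in one variable
   of the Gamma-sort is equivalent to a K-quantifier-free one whose K-terms are
   integers, which have valuation 0 or oo as the residue characteristic is 0.
   Such a formula splits into conditions on the residue field and Presburger
   conditions on x, so, Gamma being a Z-group, if phi is satisfiable then it is
   satisfied by some n.1 or by oo.

   The omitting types theorem is carried out with a sequence e_n of assignments
   in S that meet a decreasing chain of definable sets: along e_n every formula
   is eventually true or eventually false, every eventually true existential
   formula has a variable as witness, and every Gamma-variable is eventually a
   constant of Z or oo.  The elements of S_1 are the variables modulo eventual
   equality. *)

Set Implicit Arguments.
Unset Strict Implicit.
Unset Printing Implicit Defensive.

Import Order.TTheory GRing.Theory Num.Theory.
Local Open Scope ring_scope.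

(** * Assignments of the three sorts and renamings of their variables *)

Lemma push_comp (A : Type) (e : nat -> A) (j : nat) (s : nat -> nat) :
  e \o push j s = push (e j) (e \o s).
Proof. by apply/funext => -[]. Qed.

Lemma push_agree (A : Type) (a : A) (e e' : nat -> A) k :
  (forall i, (i < k)%N -> e i = e' i) ->
  forall i, (i < k.+1)%N -> push a e i = push a e' i.
Proof. by move=> h [|i] //= /h. Qed.

Section Assignments.
Variables A B C : Type.

Record asg := Asg { aK : nat -> A; aR : nat -> B; aG : nat -> C }.

Definition pushK a e := Asg (push a (aK e)) (aR e) (aG e).
Definition pushR a e := Asg (aK e) (push a (aR e)) (aG e).
Definition pushG a e := Asg (aK e) (aR e) (push a (aG e)).

Definition agree N (e e' : asg) :=
  forall i, (i < N)%N -> [/\ aK e i = aK e' i, aR e i = aR e' i & aG e i = aG e' i].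

Lemma agree_le N N' e e' : (N <= N')%N -> agree N' e e' -> agree N e e'.
Proof. by move=> le h i li; apply: h; apply: leq_trans le. Qed.


Lemma agree_pushK N a e e' : agree N e e' -> agree N (pushK a e) (pushK a e').
Proof.
move=> h i lti; split; try by case: (h i lti).
by case: i lti => //= i /ltnW /h[].
Qed.

Lemma agree_pushR N a e e' : agree N e e' -> agree N (pushR a e) (pushR a e').
Proof.
move=> h i lti; split; try by case: (h i lti).
by case: i lti => //= i /ltnW /h[].
Qed.

Lemma agree_pushG N a e e' : agree N e e' -> agree N (pushG a e) (pushG a e').
Proof.
move=> h i lti; split; try by case: (h i lti).
by case: i lti => //= i /ltnW /h[].
Qed.

End Assignments.

(** A renaming is an assignment of variables by variables, so [pushK], [pushR] and [pushG] extend it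
    when a formula loses a quantifier. *)
Definition renaming := asg nat nat nat.

(** Semantic counterpart of substitution: truth of [f] at [pull e s] is truth at [e] of [f] with its
    free variables renamed by [s]. *)
Definition pull (A B C : Type) (e : asg A B C) (s : renaming) : asg A B C :=
  Asg (aK e \o aK s) (aR e \o aR s) (aG e \o aG s).

Lemma agree_pull (A B C : Type) (e : asg A B C) N s s' :
  agree N s s' -> agree N (pull e s) (pull e s').
Proof. by move=> h i /h[/= -> -> ->]. Qed.

Lemma pull_pushK (A B C : Type) (e : asg A B C) j s :
  pull e (pushK j s) = pushK (aK e j) (pull e s).
Proof. by rewrite /pull /pushK /= push_comp. Qed.

Lemma pull_pushR (A B C : Type) (e : asg A B C) j s :
  pull e (pushR j s) = pushR (aR e j) (pull e s).
Proof. by rewrite /pull /pushR /= push_comp. Qed.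

Lemma pull_pushG (A B C : Type) (e : asg A B C) j s :
  pull e (pushG j s) = pushG (aG e j) (pull e s).
Proof. by rewrite /pull /pushG /= push_comp. Qed.

Definition asg_of (M : structure) := asg (sK M) (sR M) (sG M).

Definition ssat (M : structure) (e : asg_of M) (f : formula) :=
  sat (aK e) (aR e) (aG e) f.

(** * Dependence of formulas on finitely many variables *)

Lemma Keval_agree (M : structure) k (e e' : nat -> sK M) t :
  Kterm_below k t -> (forall i, (i < k)%N -> e i = e' i) ->
  Keval e t = Keval e' t.
Proof.
by move=> b h; elim: t b => //= t IHt u IHu
  /andP[/IHt-> /IHu->].
Qed.

Lemma Reval_agree (M : structure) k r (eK eK' : nat -> sK M)
    (eR eR' : nat -> sR M) t :
  Rterm_below k r t -> (forall i, (i < k)%N -> eK i = eK' i) ->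
  (forall i, (i < r)%N -> eR i = eR' i) ->
  Reval eK eR t = Reval eK' eR' t.
Proof.
move=> b hK hR.
elim: t b => //= [t IHt u IHu|t IHt u IHu|t IHt u IHu|t b]; last first.
  by rewrite (Keval_agree b hK).
all: by move=> /andP[/IHt-> /IHu->].
Qed.

Lemma Geval_agree (M : structure) k g (eK eK' : nat -> sK M)
    (eG eG' : nat -> sG M) t :
  Gterm_below k g t -> (forall i, (i < k)%N -> eK i = eK' i) ->
  (forall i, (i < g)%N -> eG i = eG' i) ->
  Geval eK eG t = Geval eK' eG' t.
Proof.
move=> b hK hG.
elim: t b => //= [t IHt u IHu|t b]; last first.
  by rewrite (Keval_agree b hK).
by move=> /andP[/IHt-> /IHu->].
Qed.

Lemma sat_agree (M : structure) f k r g (eK eK' : nat -> sK M)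
    (eR eR' : nat -> sR M) (eG eG' : nat -> sG M) :
  formula_below k r g f -> (forall i, (i < k)%N -> eK i = eK' i) ->
  (forall i, (i < r)%N -> eR i = eR' i) ->
  (forall i, (i < g)%N -> eG i = eG' i) ->
  sat eK eR eG f <-> sat eK' eR' eG' f.
Proof.
elim: f k r g eK eK' eR eR' eG eG'
  => /= [t u|t u|t u|t u|n t|f IH|f IHf h IHh|f IH|f IH|f IH]
     k r g eK eK' eR eR' eG eG' b hK hR hG.
- by case/andP: b => b1 b2; rewrite (Keval_agree b1 hK) (Keval_agree b2 hK).
- by case/andP: b => b1 b2; rewrite (Reval_agree b1 hK hR) (Reval_agree b2 hK hR).
- by case/andP: b => b1 b2; rewrite (Geval_agree b1 hK hG) (Geval_agree b2 hK hG).
- by case/andP: b => b1 b2; rewrite (Geval_agree b1 hK hG) (Geval_agree b2 hK hG).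
- by rewrite (Geval_agree b hK hG).
- by rewrite (IH _ _ _ _ _ _ _ _ _ b hK hR hG).
- case/andP: b => b1 b2.
  by rewrite (IHf _ _ _ _ _ _ _ _ _ b1 hK hR hG)
    (IHh _ _ _ _ _ _ _ _ _ b2 hK hR hG).
- have {}IH a := IH _ _ _ _ _ _ _ _ _ b (push_agree a hK) hR hG.
  by split=> -[a Ha]; exists a; apply/IH.
- have {}IH a := IH _ _ _ _ _ _ _ _ _ b hK (push_agree a hR) hG.
  by split=> -[a Ha]; exists a; apply/IH.
- have {}IH a := IH _ _ _ _ _ _ _ _ _ b hK hR (push_agree a hG).
  by split=> -[a Ha]; exists a; apply/IH.
Qed.

Lemma Kterm_finite t : exists N, forall k, (N <= k)%N -> Kterm_below k t.
Proof.
elim: t => [i|||t [N HN] u [N' HN']|t [N HN] u [N' HN']|t [N HN] u [N' HN']].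
- by exists i.+1.
- by exists 0%N.
- by exists 0%N.
all: exists (maxn N N') => k; rewrite geq_max => /andP[l l'] /=;
  by rewrite HN ?HN'.
Qed.

Lemma Rterm_finite t :
  exists N, forall k r, (N <= k)%N -> (N <= r)%N -> Rterm_below k r t.
Proof.
elim: t => [i|||t [N HN] u [N' HN']|t [N HN] u [N' HN']|t [N HN] u [N' HN']|t].
- by exists i.+1.
- by exists 0%N.
- by exists 0%N.
4: by have [N HN] := Kterm_finite t; exists N => k r /HN.
all: exists (maxn N N') => k r; rewrite !geq_max => /andP[l l'] /andP[m m'] /=;
  by rewrite HN ?HN'.
Qed.

Lemma Gterm_finite t :
  exists N, forall k g, (N <= k)%N -> (N <= g)%N -> Gterm_below k g t.
Proof.
elim: t => [i||||t [N HN] u [N' HN']|t].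
- by exists i.+1.
- by exists 0%N.
- by exists 0%N.
- by exists 0%N.
- by exists (maxn N N') => k r; rewrite !geq_max => /andP[l l'] /andP[m m'] /=;
    rewrite HN ?HN'.
- by have [N HN] := Kterm_finite t; exists N => k r /HN.
Qed.

Lemma formula_finite f :
  exists N, forall k r g, (N <= k)%N -> (N <= r)%N -> (N <= g)%N ->
    formula_below k r g f.
Proof.
elim: f => [t u|t u|t u|t u|n t|f [N HN]|f [N HN] h [N' HN']
           |f [N HN]|f [N HN]|f [N HN]].
- have [[N HN] [N' HN']] := (Kterm_finite t, Kterm_finite u).
  by exists (maxn N N') => k r g; rewrite !geq_max => /andP[l l'] _ _ /=;
    rewrite HN ?HN'.
- have [[N HN] [N' HN']] := (Rterm_finite t, Rterm_finite u).
  by exists (maxn N N') => k r g; rewrite !geq_max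
    => /andP[l l'] /andP[m m'] _ /=; rewrite HN ?HN'.
- have [[N HN] [N' HN']] := (Gterm_finite t, Gterm_finite u).
  by exists (maxn N N') => k r g; rewrite !geq_max
    => /andP[l l'] _ /andP[m m'] /=; rewrite HN ?HN'.
- have [[N HN] [N' HN']] := (Gterm_finite t, Gterm_finite u).
  by exists (maxn N N') => k r g; rewrite !geq_max
    => /andP[l l'] _ /andP[m m'] /=; rewrite HN ?HN'.
- by have [N HN] := Gterm_finite t; exists N => k r g lk _ lg /=; rewrite HN.
- by exists N.
- by exists (maxn N N') => k r g; rewrite !geq_max
    => /andP[l l'] /andP[m m'] /andP[p p'] /=; rewrite HN ?HN'.
- by exists N => k r g lk lr lg; apply: HN => //; apply: leqW.
- by exists N => k r g lk lr lg; apply: HN => //; apply: leqW.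
- by exists N => k r g lk lr lg; apply: HN => //; apply: leqW.
Qed.

Lemma ssat_finite f :
  exists N, forall (M : structure) (e e' : asg_of M),
    agree N e e' -> ssat e f <-> ssat e' f.
Proof.
have [N HN] := formula_finite f; exists N => M e e' h.
by apply: (sat_agree (HN N N N _ _ _)) => // i /h[].
Qed.

(** * Blocks of quantifiers and definable sets of assignments *)

Lemma iter_ex (T : Type) (ex : formula -> formula)
    (P : formula -> (nat -> T) -> Prop) :
  (forall f e, P (ex f) e <-> exists a, P f (push a e)) ->
  forall n f e, P (iter n ex f) e <->
    exists2 e', (forall j, e' (n + j)%N = e j) & P f e'.
Proof.
move=> exP n; elim: n => [|n IH] f e.
  split=> [Pf|[e' he']]; first by exists e.
  by have -> : e' = e by apply/funext.
(* [iterSr] splits off the innermost quantifier, whose witness becomes variable 0. *)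
rewrite iterSr IH; split=> -[e' he'].
  by move=> /exP[a Pa]; exists (push a e') => // j; rewrite -he'.
move=> Pf; exists (e' \o S) => [j|]; first by rewrite /= -he'.
apply/exP; exists (e' 0%N); suff -> : push (e' 0%N) (e' \o S) = e' by [].
by apply/funext => -[].
Qed.

Definition ex_all (N : nat) (f : formula) : formula :=
  iter N FExK (iter N FExR (iter N FExG f)).

Definition shifted (A B C : Type) N (e e' : asg A B C) :=
  forall j, [/\ aK e' (N + j)%N = aK e j, aR e' (N + j)%N = aR e j
              & aG e' (N + j)%N = aG e j].

Lemma ssat_ex_all (M : structure) N f (e : asg_of M) :
  ssat e (ex_all N f) <-> exists2 e', shifted N e e' & ssat e' f.
Proof.
rewrite /ssat /ex_all.
rewrite (@iter_ex _ FExK (fun f eK => sat eK (aR e) (aG e) f)) //.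
have RP eK := @iter_ex _ FExR (fun f eR => sat eK eR (aG e) f) (fun _ _ => iff_refl _).
have GP eK eR := @iter_ex _ FExG (fun f eG => sat eK eR eG f) (fun _ _ => iff_refl _).
split=> [[eK hK /RP[eR hR /GP[eG hG fe]]]|[e' he' fe]].
  by exists (Asg eK eR eG).
exists (aK e'); first by move=> j; case: (he' j).
apply/RP; exists (aR e'); first by move=> j; case: (he' j).
by apply/GP; exists (aG e') => // j; case: (he' j).
Qed.

Section Definability.
Variable M : structure.

Definition definable (P : asg_of M -> Prop) :=
  exists f, forall e, P e <-> ssat e f.

Lemma definable_and P Q :
  definable P -> definable Q -> definable (fun e => P e /\ Q e).
Proof.
by move=> [f Hf] [g Hg]; exists (FAnd f g) => e; rewrite Hf Hg.
Qed.

Lemma definable_finite P : definable P ->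
  exists N, forall e e', agree N e e' -> P e -> P e'.
Proof.
move=> [f Pf]; have [N HN] := ssat_finite f; exists N => e e' /HN h.
by rewrite !Pf h.
Qed.

Lemma definable_all (n : nat) (P : nat -> asg_of M -> Prop) :
  (forall i, definable (P i)) ->
  definable (fun e => forall i, (i < n)%N -> P i e).
Proof.
move=> defP; elim: n => [|n [f Hf]]; first by exists (FEqK KZero KZero).
have [g Hg] := defP n; exists (FAnd f g) => e.
rewrite /ssat /= -[sat _ _ _ f]/(ssat e f).
rewrite -[sat _ _ _ g]/(ssat e g) -Hf -Hg; split=> [h|[h hn] i].
  by split=> [i ltin|]; apply: h => //; apply: leqW.
by rewrite ltnS leq_eqVlt => /orP[/eqP->|/h].
Qed.

(* The renaming is expressed by N new variables, quantified existentially and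
   equated to the old ones, which avoids substitution under binders. *)
Lemma definable_ren f s : definable (fun e : asg_of M => ssat (pull e s) f).
Proof.
have [N HN] := ssat_finite f.
have [h Hh] : definable (fun e : asg_of M => ssat e f /\ forall i, (i < N)%N ->
    [/\ aK e i = aK e (N + aK s i)%N, aR e i = aR e (N + aR s i)%N
      & aG e i = aG e (N + aG s i)%N]).
  apply: definable_and; first by exists f.
  apply: (@definable_all _ (fun i e => [/\ aK e i = aK e (N + aK s i)%N,
    aR e i = aR e (N + aR s i)%N & aG e i = aG e (N + aG s i)%N])) => i.
  exists (FAnd (FEqK (KVar i) (KVar (N + aK s i)))
         (FAnd (FEqR (RVar i) (RVar (N + aR s i)))
               (FEqG (GVar i) (GVar (N + aG s i))))) => e.
  by rewrite /ssat /=; split=> [[]|[? []]].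
exists (ex_all N h) => e; rewrite ssat_ex_all; split=> [fe|[e' he' /Hh[fe' ee']]].
  pose cat T (a b : nat -> T) i := if (i < N)%N then a i else b (i - N)%N.
  have catN T a b j : @cat T a b (N + j)%N = b j.
    by rewrite /cat ltnNge leq_addr addKn.
  exists (Asg (cat _ (aK e \o aK s) (aK e)) (cat _ (aR e \o aR s) (aR e))
              (cat _ (aG e \o aG s) (aG e))).
    by move=> j; rewrite /= !catN.
  apply/Hh; split.
    by move: fe; apply HN => i lti; rewrite /= /cat lti.
  by move=> i lti; rewrite /= !catN /cat lti.
apply HN with e' => // i lti; case: (ee' i lti) => /= -> -> ->.
by have [-> _ _] := he' (aK s i); have [_ -> _] := he' (aR s i);
  have [_ _ ->] := he' (aG s i).
Qed.

End Definability.

(** * Countability of the formulas, coded as finite trees *)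

Section Countability.
Import GenTree.

Fixpoint Kcode (t : Kterm) : tree nat :=
  match t with
  | KVar i => Leaf i
  | KZero => Node 0 [::]
  | KOne => Node 1 [::]
  | KAdd t u => Node 2 [:: Kcode t; Kcode u]
  | KSub t u => Node 3 [:: Kcode t; Kcode u]
  | KMul t u => Node 4 [:: Kcode t; Kcode u]
  end.

Fixpoint Kdecode (c : tree nat) : Kterm :=
  match c with
  | Leaf i => KVar i
  | Node 1 _ => KOne
  | Node 2 [:: t; u] => KAdd (Kdecode t) (Kdecode u)
  | Node 3 [:: t; u] => KSub (Kdecode t) (Kdecode u)
  | Node 4 [:: t; u] => KMul (Kdecode t) (Kdecode u)
  | _ => KZero
  end.

Lemma KcodeK : cancel Kcode Kdecode.
Proof. by elim=> //= t -> u ->. Qed.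

Fixpoint Rcode (t : Rterm) : tree nat :=
  match t with
  | RVar i => Leaf i
  | RZero => Node 0 [::]
  | ROne => Node 1 [::]
  | RAdd t u => Node 2 [:: Rcode t; Rcode u]
  | RSub t u => Node 3 [:: Rcode t; Rcode u]
  | RMul t u => Node 4 [:: Rcode t; Rcode u]
  | RAc t => Node 5 [:: Kcode t]
  end.

Fixpoint Rdecode (c : tree nat) : Rterm :=
  match c with
  | Leaf i => RVar i
  | Node 1 _ => ROne
  | Node 2 [:: t; u] => RAdd (Rdecode t) (Rdecode u)
  | Node 3 [:: t; u] => RSub (Rdecode t) (Rdecode u)
  | Node 4 [:: t; u] => RMul (Rdecode t) (Rdecode u)
  | Node 5 [:: t] => RAc (Kdecode t)
  | _ => RZero
  end.

Lemma RcodeK : cancel Rcode Rdecode.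
Proof. by elim=> //= [t -> u ->|t -> u ->|t -> u ->|t] //; rewrite KcodeK. Qed.

Fixpoint Gcode (t : Gterm) : tree nat :=
  match t with
  | GVar i => Leaf i
  | GZero => Node 0 [::]
  | GOne => Node 1 [::]
  | GInf => Node 2 [::]
  | GAdd t u => Node 3 [:: Gcode t; Gcode u]
  | GVal t => Node 4 [:: Kcode t]
  end.

Fixpoint Gdecode (c : tree nat) : Gterm :=
  match c with
  | Leaf i => GVar i
  | Node 1 _ => GOne
  | Node 2 _ => GInf
  | Node 3 [:: t; u] => GAdd (Gdecode t) (Gdecode u)
  | Node 4 [:: t] => GVal (Kdecode t)
  | _ => GZero
  end.

Lemma GcodeK : cancel Gcode Gdecode.
Proof. by elim=> //= [t -> u ->|t] //; rewrite KcodeK. Qed.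

Fixpoint Fcode (f : formula) : tree nat :=
  match f with
  | FEqK t u => Node 0 [:: Kcode t; Kcode u]
  | FEqR t u => Node 1 [:: Rcode t; Rcode u]
  | FEqG t u => Node 2 [:: Gcode t; Gcode u]
  | FLt t u => Node 3 [:: Gcode t; Gcode u]
  | FDiv n t => Node 4 [:: Leaf n; Gcode t]
  | FNot f => Node 5 [:: Fcode f]
  | FAnd f g => Node 6 [:: Fcode f; Fcode g]
  | FExK f => Node 7 [:: Fcode f]
  | FExR f => Node 8 [:: Fcode f]
  | FExG f => Node 9 [:: Fcode f]
  end.

Fixpoint Fdecode (c : tree nat) : formula :=
  match c with
  | Node 0 [:: t; u] => FEqK (Kdecode t) (Kdecode u)
  | Node 1 [:: t; u] => FEqR (Rdecode t) (Rdecode u)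
  | Node 2 [:: t; u] => FEqG (Gdecode t) (Gdecode u)
  | Node 3 [:: t; u] => FLt (Gdecode t) (Gdecode u)
  | Node 4 [:: Leaf n; t] => FDiv n (Gdecode t)
  | Node 5 [:: f] => FNot (Fdecode f)
  | Node 6 [:: f; g] => FAnd (Fdecode f) (Fdecode g)
  | Node 7 [:: f] => FExK (Fdecode f)
  | Node 8 [:: f] => FExR (Fdecode f)
  | Node 9 [:: f] => FExG (Fdecode f)
  | _ => FEqK KZero KZero
  end.

Lemma FcodeK : cancel Fcode Fdecode.
Proof.
elim=> /= [t u|t u|t u|t u|n t|f ->|f -> g ->|f ->|f ->|f ->] //;
  by rewrite ?KcodeK ?RcodeK ?GcodeK.
Qed.

End Countability.

HB.instance Definition _ := Countable.copy formula (can_type FcodeK).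

(** * Eventual properties and generic sequences *)

Definition ev (P : nat -> Prop) := exists N, forall n, (N <= n)%N -> P n.

Lemma ev_all (P : nat -> Prop) : (forall n, P n) -> ev P.
Proof. by move=> h; exists 0%N. Qed.

(** The filter of cofinite sets is proper. This brings a conclusion that does not mention [n] back
    from the sequence. *)
Lemma ev_const P : ev (fun=> P) -> P.
Proof. by move=> [N /(_ N (leqnn N))]. Qed.

Lemma ev_and P Q : ev P -> ev Q -> ev (fun n => P n /\ Q n).
Proof.
move=> [N HN] [N' HN']; exists (maxn N N') => n.
by rewrite geq_max => /andP[/HN ? /HN'].
Qed.

Lemma ev_sub (P Q : nat -> Prop) : (forall n, P n -> Q n) -> ev P -> ev Q.
Proof. by move=> h [N HN]; exists N => n /HN /h. Qed.

Lemma ev_sub2 (P Q R : nat -> Prop) :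
  (forall n, P n -> Q n -> R n) -> ev P -> ev Q -> ev R.
Proof.
by move=> h hP hQ; apply: ev_sub (ev_and hP hQ) => n []; apply: h.
Qed.

(** The Rasiowa-Sikorski argument: the countably many requirements are met one after the other along
    a decreasing chain of nonempty conditions, and the n-th point is chosen in the n-th
    condition. *)
Lemma generic_sequence (T : Type) (C : (T -> Prop) -> Prop) (I : countType)
    (D : I -> (T -> Prop) -> Prop) (P0 : T -> Prop) :
  (forall i P, C P -> (exists e, P e) ->
     exists Q, [/\ C Q, exists e, Q e, forall e, Q e -> P e & D i Q]) ->
  C P0 -> (exists e, P0 e) ->
  exists e : nat -> T, forall i, exists2 Q, D i Q & ev (fun n => Q (e n)).
Proof.
move=> dense CP0 neP0.
pose cond := {P : T -> Prop | C P /\ exists e, P e}.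
have /choice[wit witP] (p : cond) : exists e, sval p e by case: p => P [].
have /choice[step stepP] (np : nat * cond) : exists q : cond,
    (forall e, sval q e -> sval np.2 e) /\
    (if unpickle np.1 is Some i then D i (sval q) else True).
  case: np => n [P [CP neP]] /=.
  case: (unpickle n) => [i|]; last by exists (exist _ P (conj CP neP)).
  have [Q [CQ neQ QP DQ]] := dense i P CP neP.
  by exists (exist _ Q (conj CQ neQ)).
pose fix p n : cond :=
  if n is m.+1 then step (m, p m) else exist _ P0 (conj CP0 neP0).
have p_le m n e : (m <= n)%N -> sval (p n) e -> sval (p m) e.
  elim: n => [|n IH]; first by case: m.
  rewrite leq_eqVlt => /orP[/eqP->//|/IH h].
  by have [+ _] := stepP (n, p n) => /(_ e) /[apply] /h.
(* Index [i] is treated at stage [pickle i], whose outcome is the condition numbered one higher. *)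
exists (wit \o p) => i; exists (sval (p (pickle i).+1)).
  by have [_] := stepP (pickle i, p (pickle i)); rewrite /= pickleK.
by exists (pickle i).+1 => n len; apply: p_le len _; apply: witP.
Qed.

(** Renamings given by finite lists are countable in number and, by [ren_of_agree], suffice for any
    single formula. *)
Definition ren_of (s : seq nat * seq nat * seq nat) : renaming :=
  Asg (nth 0%N s.1.1) (nth 0%N s.1.2) (nth 0%N s.2).

Lemma ren_of_agree (s : renaming) N : exists s', agree N s (ren_of s').
Proof.
exists (mkseq (aK s) N, mkseq (aR s) N, mkseq (aG s) N) => i lti.
by rewrite /= !nth_mkseq.
Qed.

(** Yields variables outside the range of [ren_of s]. The default 0 belongs to that range, hence the
    bound 1 for the empty list. *)
Lemma nth_bounded (s : seq nat) : exists B, forall i, (nth 0 s i < B)%N.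
Proof.
elim: s => [|a s [B HB]]; first by exists 1%N => i; rewrite nth_nil.
by exists (maxn a.+1 B) => -[|i] /=; rewrite leq_max ?leqnn // HB orbT.
Qed.

Definition upd (A : Type) (e : nat -> A) (j : nat) (a : A) (i : nat) : A :=
  if i == j then a else e i.

Lemma upd_push (A : Type) (e : nat -> A) (j : nat) (a : A) (s : nat -> nat) :
  (forall i, (s i < j)%N) -> upd e j a \o push j s = push a (e \o s).
Proof.
move=> lts; apply/funext => -[|i] /=; rewrite /upd ?eqxx //.
by have := lts i; rewrite ltn_neqAle => /andP[/negPf->].
Qed.

Lemma upd_lt (A : Type) (e : nat -> A) (j : nat) (a : A) i :
  (i < j)%N -> upd e j a i = e i.
Proof. by rewrite ltn_neqAle /upd => /andP[/negPf->]. Qed.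

(** * Generic assignments: decisions, witnesses and the omitted type *)

Section GenericAssignments.
Variables (M : structure) (T : Type) (emb : T -> sG M).
Hypothesis definable_emb :
  forall i c, definable (fun e : asg_of M => aG e i = emb c).
(** The type to be omitted is not isolated: no satisfiable definable condition forces a variable of
    the Gamma-sort out of the range of [emb]. *)
Hypothesis omit : forall P : asg_of M -> Prop, definable P ->
  forall i, (exists e, P e) -> exists c, exists2 e, P e & aG e i = emb c.

(** The element of ['I_4] selects the kind of requirement: 0 decides [f], while 1, 2 and 3 ask for a
    witness in the K-sort, the residue sort or the Gamma-sort. The right summand serves to omit the
    type. *)
Let idx : Type := ('I_4 * formula * (seq nat * seq nat * seq nat) + nat)%type.

Let req (t : idx) (Q : asg_of M -> Prop) : Prop :=
  match t with
  | inl (k, f, s) =>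
    let s := ren_of s in
    match val k with
    | 0 => (forall e, Q e -> ssat (pull e s) f) \/
           (forall e, Q e -> ~ ssat (pull e s) f)
    | 1 => (forall e, Q e -> ~ ssat (pull e s) (FExK f)) \/
           exists j, forall e, Q e -> ssat (pull e (pushK j s)) f
    | 2 => (forall e, Q e -> ~ ssat (pull e s) (FExR f)) \/
           exists j, forall e, Q e -> ssat (pull e (pushR j s)) f
    | _ => (forall e, Q e -> ~ ssat (pull e s) (FExG f)) \/
           exists j, forall e, Q e -> ssat (pull e (pushG j s)) f
    end
  | inr i => exists c, forall e, Q e -> aG e i = emb c
  end.

Let extends (P : asg_of M -> Prop) (D : (asg_of M -> Prop) -> Prop) :=
  exists Q, [/\ definable Q, exists e, Q e, forall e, Q e -> P e & D Q].

Let extends_and (P R : asg_of M -> Prop) (D : (asg_of M -> Prop) -> Prop) :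
  definable P -> definable R -> (exists2 e, P e & R e) ->
  ((forall Q : asg_of M -> Prop, (forall e, Q e -> R e) -> D Q)) -> extends P D.
Proof.
move=> dP dR [e Pe Re] h; exists (fun e => P e /\ R e); split.
- exact: definable_and.
- by exists e.
- by move=> ? [].
- by apply: h => ? [].
Qed.

(** Either [P] meets the set where the formula holds and is cut down to it, or [P] already refutes
    the formula. *)
Let req_dense t P : definable P -> (exists e, P e) -> extends P (req t).
Proof.
move=> dP neP; have [N HN] := definable_finite dP.
case: t => [[[k f] s]|i]; last first.
  have [c [e Pe ec]] := omit dP i neP.
  apply: (extends_and dP (definable_emb i c)); first by exists e.
  by move=> Q QR; exists c.
have [BK HBK] := nth_bounded s.1.1.
have [BR HBR] := nth_bounded s.1.2.
have [BG HBG] := nth_bounded s.2.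
rewrite /req; case: (val k) => [|[|[|_]]] {k}.
- have [[e Pe fe]|nof] := EM (exists2 e, P e & ssat (pull e (ren_of s)) f).
    apply: (extends_and dP (definable_ren M f (ren_of s))); first by exists e.
    by move=> Q QR; left.
  by exists P; split=> //; right=> e Pe fe; apply: nof; exists e.
- have [[e Pe [a fa]]|nof] :=
    EM (exists2 e, P e & ssat (pull e (ren_of s)) (FExK f)); last first.
    by exists P; split=> //; left=> e Pe fe; apply: nof; exists e.
  (* Variable [j] is fresh: [P] depends only on variables below [N], and the renaming takes values
     below [BK] in this sort. Storing the witness [a] there disturbs neither. *)
  pose j := maxn N BK.
  apply: (extends_and dP (definable_ren M f (pushK j (ren_of s)))).
    exists (Asg (upd (aK e) j a) (aR e) (aG e)).
      apply: HN Pe => i lti /=; rewrite upd_lt //.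
      by apply: leq_trans lti _; apply: leq_maxl.
    rewrite /ssat /= upd_push //= => i.
    by apply: leq_trans (HBK i) _; apply: leq_maxr.
  by move=> Q QR; right; exists j.
- have [[e Pe [a fa]]|nof] :=
    EM (exists2 e, P e & ssat (pull e (ren_of s)) (FExR f)); last first.
    by exists P; split=> //; left=> e Pe fe; apply: nof; exists e.
  pose j := maxn N BR.
  apply: (extends_and dP (definable_ren M f (pushR j (ren_of s)))).
    exists (Asg (aK e) (upd (aR e) j a) (aG e)).
      apply: HN Pe => i lti /=; rewrite upd_lt //.
      by apply: leq_trans lti _; apply: leq_maxl.
    rewrite /ssat /= upd_push //= => i.
    by apply: leq_trans (HBR i) _; apply: leq_maxr.
  by move=> Q QR; right; exists j.
- have [[e Pe [a fa]]|nof] :=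
    EM (exists2 e, P e & ssat (pull e (ren_of s)) (FExG f)); last first.
    by exists P; split=> //; left=> e Pe fe; apply: nof; exists e.
  pose j := maxn N BG.
  apply: (extends_and dP (definable_ren M f (pushG j (ren_of s)))).
    exists (Asg (aK e) (aR e) (upd (aG e) j a)).
      apply: HN Pe => i lti /=; rewrite upd_lt //.
      by apply: leq_trans lti _; apply: leq_maxl.
    rewrite /ssat /= upd_push //= => i.
    by apply: leq_trans (HBG i) _; apply: leq_maxr.
  by move=> Q QR; right; exists j.
Qed.

Lemma generic_assignments : exists e : nat -> asg_of M,
  [/\ forall f s, ev (fun n => ssat (pull (e n) s) f) \/
                  ev (fun n => ~ ssat (pull (e n) s) f),
      forall f s, ev (fun n => ssat (pull (e n) s) (FExK f)) ->
        exists j, ev (fun n => ssat (pull (e n) (pushK j s)) f),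
      forall f s, ev (fun n => ssat (pull (e n) s) (FExR f)) ->
        exists j, ev (fun n => ssat (pull (e n) (pushR j s)) f),
      forall f s, ev (fun n => ssat (pull (e n) s) (FExG f)) ->
        exists j, ev (fun n => ssat (pull (e n) (pushG j s)) f)
    & forall i, exists c, ev (fun n => aG (e n) i = emb c)].
Proof.
have [||e eP] := @generic_sequence _ (@definable M) idx req (fun=> True) req_dense.
- by exists (FEqK KZero KZero).
- by exists (Asg (fun=> s0K M) (fun=> s0R M) (fun=> s0G M)).
(* The requirements concern renamings given by lists, but [f] and [g] see only finitely many
   variables. Below, [g] is [f] itself or [f] under one quantifier. *)
have red f g s : exists s', forall n,
    [/\ ssat (pull (e n) s) g <-> ssat (pull (e n) (ren_of s')) g,
        forall j, ssat (pull (e n) (pushK j s)) f <->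
          ssat (pull (e n) (pushK j (ren_of s'))) f,
        forall j, ssat (pull (e n) (pushR j s)) f <->
          ssat (pull (e n) (pushR j (ren_of s'))) f
      & forall j, ssat (pull (e n) (pushG j s)) f <->
          ssat (pull (e n) (pushG j (ren_of s'))) f].
  have [N HN] := ssat_finite f; have [N' HN'] := ssat_finite g.
  have [s' ss'] := ren_of_agree s (maxn N N').
  have aN := agree_le (leq_maxl N N') ss'.
  have aN' := agree_le (leq_maxr N N') ss'.
  exists s' => n; split=> [|j|j|j]; [apply: HN'|apply: HN..]; apply: agree_pull => //.
  - exact: agree_pushK.
  - exact: agree_pushR.
  - exact: agree_pushG.
exists e; split.
- move=> f s; have [s' Hs'] := red f f s.
  have [Q + QE] := eP (inl (inord 0, f, s')).
  rewrite /req /= inordK // => -[h|h]; [left|right];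
    by apply: ev_sub QE => n /h; have [-> _ _ _] := Hs' n.
- move=> f s exf; have [s' Hs'] := red f (FExK f) s.
  have [Q + QE] := eP (inl (inord 1, f, s')).
  rewrite /req /= inordK // => -[h|[j h]]; last first.
    by exists j; apply: ev_sub QE => n /h; have [_ -> _ _] := Hs' n.
  (* Otherwise the existential formula would be both true and false from some stage on. *)
  suff: ev (fun=> False) by move/ev_const.
  by apply: ev_sub2 exf QE => n + /h; have [-> _ _ _] := Hs' n.
- move=> f s exf; have [s' Hs'] := red f (FExR f) s.
  have [Q + QE] := eP (inl (inord 2, f, s')).
  rewrite /req /= inordK // => -[h|[j h]]; last first.
    by exists j; apply: ev_sub QE => n /h; have [_ _ -> _] := Hs' n.
  suff: ev (fun=> False) by move/ev_const.
  by apply: ev_sub2 exf QE => n + /h; have [-> _ _ _] := Hs' n.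
- move=> f s exf; have [s' Hs'] := red f (FExG f) s.
  have [Q + QE] := eP (inl (inord 3, f, s')).
  rewrite /req /= inordK // => -[h|[j h]]; last first.
    by exists j; apply: ev_sub QE => n /h; have [_ _ _ ->] := Hs' n.
  suff: ev (fun=> False) by move/ev_const.
  by apply: ev_sub2 exf QE => n + /h; have [-> _ _ _] := Hs' n.
- move=> i; have [Q [c h] QE] := eP (inr i); exists c.
  by apply: ev_sub QE => n; apply: h.
Qed.

End GenericAssignments.

(** * Presburger formulas and Z-groups *)

(** Variables from [k] on are replaced by 0. This produces sentences, the only formulas about which
    [Z_group] speaks. *)
Fixpoint ptrunc_term (k : nat) (t : pterm) : pterm :=
  match t with
  | PVar i => if (i < k)%N then PVar i else PZero
  | PAdd t u => PAdd (ptrunc_term k t) (ptrunc_term k u)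
  | _ => t
  end.

Fixpoint ptrunc (k : nat) (f : pformula) : pformula :=
  match f with
  | PEq t u => PEq (ptrunc_term k t) (ptrunc_term k u)
  | PLt t u => PLt (ptrunc_term k t) (ptrunc_term k u)
  | PDiv n t => PDiv n (ptrunc_term k t)
  | PNot f => PNot (ptrunc k f)
  | PAnd f g => PAnd (ptrunc k f) (ptrunc k g)
  | PEx f => PEx (ptrunc k.+1 f)
  end.

Lemma ptrunc_term_below k t : pterm_below k (ptrunc_term k t).
Proof. by elim: t => //= [i|t -> u -> //]; case: ifP. Qed.

Lemma ptrunc_below k f : pformula_below k (ptrunc k f).
Proof.
elim: f k => /= [t u k|t u k|n t k|f IH k|f IHf g IHg k|f IH k];
  by rewrite ?ptrunc_term_below ?IHf ?IHg ?IH.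
Qed.

Fixpoint pnum (n : nat) : pterm := if n is m.+1 then PAdd POne (pnum m) else PZero.

(** Defines the [m]-th multiple of 1. As subtraction is not in the language, the value [- n.+1] of
    [Negz n] is expressed by adding [n.+1]. *)
Definition pis (m : int) : pformula :=
  match m with
  | Posz n => PEq (PVar 0) (pnum n)
  | Negz n => PEq (PAdd (PVar 0) (pnum n.+1)) PZero
  end.

Fixpoint por (s : seq pformula) : pformula :=
  if s is f :: s' then PNot (PAnd (PNot f) (PNot (por s'))) else PNot (PEq PZero PZero).

Section Presburger.
Variables (G : porderZmodType) (one : G).

Lemma psat_trunc_term k (e : nat -> G) t :
  peval one e (ptrunc_term k t) = peval one (fun i => if (i < k)%N then e i else 0) t.
Proof. by elim: t => //= [i|t -> u ->//]; case: ifP. Qed.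

Lemma psat_ext (e e' : nat -> G) f : e =1 e' -> psat one e f <-> psat one e' f.
Proof. by move=> /funext ->. Qed.

Lemma psat_trunc k (e : nat -> G) f :
  psat one e (ptrunc k f) <-> psat one (fun i => if (i < k)%N then e i else 0) f.
Proof.
elim: f k e => /= [t u|t u|n t|f IH|f IHf g IHg|f IH] k e.
- by rewrite !psat_trunc_term.
- by rewrite !psat_trunc_term.
- by rewrite !psat_trunc_term.
- by rewrite IH.
- by rewrite IHf IHg.
by split=> -[a Pa]; exists a; move: Pa; rewrite IH; apply psat_ext => -[].
Qed.

Lemma peval_num (e : nat -> G) n : peval one e (pnum n) = one *+ n.
Proof. by elim: n => //= n ->; rewrite mulrS. Qed.

Lemma psat_is (e : nat -> G) m : psat one e (pis m) <-> e 0%N = one *~ m.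
Proof.
case: m => n /=; rewrite ?peval_num // -mulrS NegzE mulrNz.
split=> [/eqP|->]; first by rewrite addr_eq0 => /eqP.
by rewrite addNr.
Qed.

Lemma psat_or (e : nat -> G) (I : finType) (A : {set I}) (f : I -> pformula) :
  psat one e (por [seq f i | i <- enum A]) <-> exists2 i, i \in A & psat one e (f i).
Proof.
transitivity (exists2 i, i \in enum A & psat one e (f i)); last first.
  by split=> -[i iA fi]; exists i => //; move: iA; rewrite mem_enum.
elim: (enum A) => [|i s IH] /=; first by split=> // -[].
split=> [nn|[j]].
  have [fi|nfi] := EM (psat one e (f i)); first by exists i => //; rewrite mem_head.
  have [/IH[j js fj]|ns] := EM (psat one e (por [seq f i | i <- s])).
    by exists j => //; rewrite in_cons js orbT.
  by case: nn.
rewrite in_cons => /orP[/eqP-> fi [] //|js fj [_]]; apply; apply/IH.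
by exists j.
Qed.

Lemma ptrue_ex f : ptrue one (PEx (ptrunc 1 f)) <->
  exists a, psat one (push a (fun=> 0)) f.
Proof.
have h e : psat one e (PEx (ptrunc 1 f)) <->
    exists a, psat one (push a (fun=> 0)) f.
  by split=> /= -[a Pa]; exists a; move: Pa; rewrite psat_trunc;
    apply psat_ext => -[].
by split=> [/(_ (fun=> 0))/h|ex e]; last exact/h.
Qed.

End Presburger.

Section ZGroup.
Variables (G : porderZmodType) (one : G).
Hypothesis hG : Z_group one.

Lemma Z_group_ex f :
  (exists a, psat one (push a (fun=> 0)) f) <->
  (exists a : int, psat 1 (push a (fun=> 0)) f).
Proof.
have := hG.2 (PEx (ptrunc 1 f)) (ptrunc_below 1 f).
by rewrite !ptrue_ex.
Qed.

(** Since [pis m] defines [one *~ m], a property of this element is an existential statement, which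
    transfers. *)
Lemma Z_group_at f (m : int) :
  psat one (push (one *~ m) (fun=> 0)) f <-> psat 1 (push m (fun=> 0)) f.
Proof.
have isP (H : porderZmodType) (o : H) :
    psat o (push (o *~ m) (fun=> 0)) f <->
    exists a, psat o (push a (fun=> 0)) (PAnd (pis m) f).
  split=> [fm|[a [/psat_is/= -> //]]].
  by exists (o *~ m); split=> //; apply/psat_is.
by rewrite isP Z_group_ex -isP intz.
Qed.

(** Satisfiability transfers to Z, where a solution is some [m], and the truth of [f] at [m]
    transfers back. This is why nonstandard elements can be omitted. *)
Lemma Z_group_definable f a : psat one (push a (fun=> 0)) f ->
  exists m : int, psat one (push (one *~ m) (fun=> 0)) f.
Proof.
move=> fa; have /Z_group_ex[m fm] : exists a, psat one (push a (fun=> 0)) f.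
  by exists a.
by exists m; apply/Z_group_at.
Qed.

Lemma Z_group_gt0 (m : int) : (0 < one *~ m) = (0 < m).
Proof.
by apply/idP/idP => h;
  have := Z_group_at (PLt PZero (PVar 0)) m; rewrite /= => -[h1 h2]; auto.
Qed.

Lemma Z_group_eq0 (m : int) : (one *~ m == 0) = (m == 0).
Proof.
by apply/eqP/eqP => h;
  have := Z_group_at (PEq (PVar 0) PZero) m; rewrite /= => -[h1 h2]; auto.
Qed.

Lemma Z_group_div n (m : int) :
  (exists b, one *~ m = b *+ n.+2) <-> (exists b, m = b *+ n.+2).
Proof. exact: (Z_group_at (PDiv n (PVar 0)) m). Qed.

Lemma ordered_group_lt (x y : G) : (x < y) = (0 < y - x).
Proof.
have [_ D] := hG.1.
rewrite !lt_def subr_eq0; congr andb.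
by apply/idP/idP => [/(D _ _ (- x))|/(D _ _ x)]; rewrite ?subrr // subrK add0r.
Qed.

Lemma Z_group_lt (m n : int) : (one *~ m < one *~ n) = (m < n).
Proof. by rewrite ordered_group_lt -mulrzBr Z_group_gt0 subr_gt0. Qed.

Lemma Z_group_inj : injective (fun m : int => one *~ m).
Proof.
by move=> m n /eqP; rewrite -subr_eq0 -mulrzBr Z_group_eq0 subr_eq0 => /eqP.
Qed.

End ZGroup.

(** * Omitting nonstandard values *)

Section Valuation.
Variables (K R : fieldType) (G : porderZmodType) (v : K -> option G) (res : K -> R).
Hypotheses (hv : is_valuation v) (hres : is_residue_map v res).

(** Adding [x] to either comparison of [x] with 0 gives the reverse one. It is applied to the value
    of -1. *)
Lemma ordered_group_double (x : G) : x + x = 0 -> x = 0.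
Proof.
move=> xx0; case: hv => -[tot add] _ _ _ _.
apply/eqP; rewrite eq_le.
by case/orP: (tot x 0) => le0; have := add _ _ x le0;
  rewrite xx0 add0r => ge0; rewrite le0 ge0.
Qed.

Lemma valuation0 : v 0 = None.
Proof. by case: hv => _ v0 _ _ _; apply/v0. Qed.

Lemma valuationM x y : v (x * y) = add_oo (v x) (v y).
Proof. by case: hv. Qed.

Lemma val_neq0 x : x != 0 -> exists g, v x = Some g.
Proof.
move=> /eqP nx0; case: hv => _ v0 _ _ _.
by case E: (v x) => [g|]; [exists g | case: nx0; apply/v0].
Qed.

Lemma valuation1 : v 1 = Some 0.
Proof.
have [g vg] := val_neq0 (oner_neq0 K).
have := valuationM 1 1; rewrite mulr1 vg /= => -[/eqP].
by rewrite -subr_eq0 opprD addrA subrr sub0r oppr_eq0 => /eqP->.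
Qed.

Lemma valuationN x : v (- x) = v x.
Proof.
have vN1 : v (-1) = Some 0.
  have [g vg] := val_neq0 (lreg_neq0 (@lregN _ _ (@lreg1 K))).
  have := valuationM (-1) (-1); rewrite mulrNN mulr1 valuation1 vg /= => -[/esym].
  by move=> /ordered_group_double->.
by rewrite -mulN1r valuationM vN1; case: (v x) => //= g; rewrite add0r.
Qed.

Lemma val_unit x : le_oo (Some 0) (v x) -> res x != 0 -> v x = Some 0.
Proof.
move=> Ox /eqP rx0; case: hres => _ _ _ resM _.
have [//|] := EM (v x = Some 0) => nv; case: rx0; apply/resM => //.
move: Ox nv; case: (v x) => [g|] //=; rewrite le_eqVlt => /orP[/eqP<-|//].
by case.
Qed.

(** Both claims go through one induction because [res] is additive only on the valuation ring. *)
Lemma val_nat_res n : le_oo (Some 0) (v n%:R) /\ res n%:R = n%:R.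
Proof.
case: (hv) => _ _ _ ult _; case: (hres) => res1 resD _ resM _.
elim: n => [|n [On rn]].
  by rewrite valuation0; split=> //; apply/resM; rewrite valuation0.
split; last by rewrite -addn1 !natrD resD // ?valuation1 /= ?rn ?res1.
have := ult n%:R 1; rewrite natr1 valuation1 /min_oo.
case: (v n%:R) On => [g|] //= g0; first case: ifP => _;
  by case: (v _) => [g'|] //; apply: le_trans.
Qed.

(** In residue characteristic 0 a positive natural number has nonzero residue, hence is a unit. *)
Lemma val_int (z : int) : [pchar R] =i pred0 ->
  v z%:~R = None \/ v z%:~R = Some 0.
Proof.
move=> chR; have natP n : v n%:R = None \/ v n%:R = Some 0.
  case: n => [|n]; first by left; rewrite valuation0.
  have [On rn] := val_nat_res n.+1; right; apply: val_unit => //.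
  by rewrite rn (pcharf0P R).1.
by case: z => n; rewrite ?NegzE ?rmorphN /= ?valuationN; apply: natP.
Qed.

End Valuation.

(** * Splitting of K-quantifier-free formulas into residue field and Presburger conditions *)

Section Splitting.
Variables (S : vf_data) (res : vfK S -> vfR S).
Hypothesis hchR : [pchar (vfR S)] =i pred0.
Hypotheses (hv : is_valuation (@vfv S)) (hres : is_residue_map (@vfv S) res).

Lemma Keval0_int t : exists z : int, Keval (fun=> 0 : sK S) t = z%:~R.
Proof.
elim: t => /= [i|||t [y ->] u [z ->]|t [y ->] u [z ->]|t [y ->] u [z ->]].
- by exists 0.
- by exists 0.
- by exists 1.
- by exists (y + z); rewrite rmorphD.
- by exists (y - z); rewrite rmorphB.
- by exists (y * z); rewrite rmorphM.
Qed.

(** Presburger formulas know no infinite value, so the set [inf] of variables equal to oo is fixed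
    beforehand. *)
Definition with_oo (inf : nat -> bool) (e : nat -> vfG S) (i : nat) : sG S :=
  if inf i then None else Some (e i).

(** Whether a term is infinite depends on [inf] alone: the K-terms are integers, with value 0 or oo,
    and oo absorbs under addition. The case [o = None] is that of an infinite term. *)
Lemma Geval_split inf t : exists o : option pterm, forall e,
  Geval (fun=> 0 : sK S) (with_oo inf e) t = omap (peval (vf1 S) e) o.
Proof.
elim: t => [i||||t [o Ho] u [o' Ho']|t].
- by exists (if inf i then None else Some (PVar i)) => e /=; rewrite /with_oo; case: ifP.
- by exists (Some PZero).
- by exists (Some POne).
- by exists None.
- exists (if o is Some t then if o' is Some u then Some (PAdd t u) else None else None).
  by move=> e /=; rewrite Ho Ho'; case: o {Ho} => [?|] //; case: o' {Ho'}.
have [z Hz] := Keval0_int t; case: (val_int hv hres z hchR) => vz.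
  by exists None => e /=; rewrite Hz vz.
by exists (Some PZero) => e /=; rewrite Hz vz.
Qed.

Definition pconst (b : bool) : pformula :=
  if b then PEq PZero PZero else PNot (PEq PZero PZero).

Lemma psat_const (G : porderZmodType) (one : G) (e : nat -> G) b :
  psat one e (pconst b) <-> b.
Proof. by case: b => /=; split. Qed.

(* The residue field parameters select one of finitely many Presburger
   formulas. *)
Lemma K_quantifier_free_split g : K_quantifier_free g -> forall inf,
  exists (I : finType) (B : I -> pformula), forall eR, exists i, forall e,
    sat (fun=> 0 : sK S) eR (with_oo inf e) g <-> psat (vf1 S) e (B i).
Proof.
(* Conditions on the two fields do not involve [e]: for given [eR] they are constantly true or
   constantly false. *)
have const (P : (nat -> sR S) -> Prop) : exists (I : finType) (B : I -> pformula),
    forall eR, exists i, forall e, P eR <-> psat (vf1 S) e (B i).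
  exists bool, pconst => eR; exists `[< P eR >] => e.
  by rewrite psat_const asboolE.
have single inf (P : (nat -> sG S) -> Prop) f :
    (forall e, P (with_oo inf e) <-> psat (vf1 S) e f) ->
    exists (I : finType) (B : I -> pformula),
    forall eR : nat -> sR S, exists i, forall e,
      P (with_oo inf e) <-> psat (vf1 S) e (B i).
  by move=> h; exists unit, (fun=> f) => eR; exists tt.
elim: g => /= [t u|t u|t u|t u|n t|f IH|f IHf h IHh|f _|f IH|f IH] qf inf.
- exact (const (fun eR => Keval (fun=> 0 : sK S) t = Keval (fun=> 0 : sK S) u)).
- exact: (const (fun eR => Reval (fun=> 0 : sK S) eR t = Reval (fun=> 0 : sK S) eR u)).
- have [[o Ho] [o' Ho']] := (Geval_split inf t, Geval_split inf u).
  pose f := match o, o' with Some t, Some u => PEq t u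
                           | None, None => pconst true | _, _ => pconst false end.
  apply: (single inf (fun eG => Geval (fun=> 0 : sK S) eG t =
    Geval (fun=> 0 : sK S) eG u) f) => e.
  rewrite Ho Ho' /f; case: (o) => [t'|]; case: (o') => [u'|] //=; try by split=> // -[].
  by split=> [[]|->].
- have [[o Ho] [o' Ho']] := (Geval_split inf t, Geval_split inf u).
  pose f := match o, o' with Some t, Some u => PLt t u
                           | Some _, None => pconst true | _, _ => pconst false end.
  apply: (single inf (fun eG => lt_oo (Geval (fun=> 0 : sK S) eG t)
    (Geval (fun=> 0 : sK S) eG u)) f) => e.
  by rewrite Ho Ho' /f; case: (o) => [t'|]; case: (o') => [u'|] //=; split=> // -[].
- have [o Ho] := Geval_split inf t.
  pose f := if o is Some t then PDiv n t else pconst true.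
  apply: (single inf (fun eG => div_oo n.+2 (Geval (fun=> 0 : sK S) eG t)) f) => e.
  by rewrite Ho /f; case: (o).
- have [I [B HB]] := IH qf inf; exists I, (PNot \o B) => eR.
  by have [i Hi] := HB eR; exists i => e; rewrite Hi.
- case/andP: qf => qf qh; have [[I [B HB]] [I' [B' HB']]] := (IHf qf inf, IHh qh inf).
  exists (I * I')%type, (fun i => PAnd (B i.1) (B' i.2)) => eR.
  have [[i Hi] [i' Hi']] := (HB eR, HB' eR).
  by exists (i, i') => e; rewrite Hi Hi'.
- by [].
- have [I [B HB]] := IH qf inf.
  (* An index is now the set [A] of the old indices reached by some value of the bound residue
     variable, and the formula is the disjunction over [A]. *)
  exists ({set I} : finType), (fun A : {set I} => por [seq B i | i <- enum A]) => eR.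
  pose A := [set i | `[< exists a, forall e, sat (fun=> 0 : sK S) (push a eR)
                           (with_oo inf e) f <-> psat (vf1 S) e (B i) >]].
  exists A => e; rewrite psat_or; split=> [[a fa]|[i]].
    have [i Hi] := HB (push a eR); exists i; last by rewrite -Hi.
    by rewrite inE; apply/asboolP; exists a.
  by rewrite inE => /asboolP[a Ha] Bi; exists a; rewrite Ha.
- have [[I [B HB]] [I' [B' HB']]] := (IH qf (push false inf), IH qf (push true inf)).
  (* The bound variable is finite or oo, so the quantifier becomes a disjunction over two patterns,
     written by De Morgan. *)
  exists (I * I')%type,
    (fun i => PNot (PAnd (PNot (PEx (B i.1))) (PNot (PEx (B' i.2))))) => eR.
  have [[i Hi] [i' Hi']] := (HB eR, HB' eR).
  exists (i, i') => e /=.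
  have fin a : push (Some a) (with_oo inf e) = with_oo (push false inf) (push a e).
    by apply/funext => -[].
  have infi a : push None (with_oo inf e) = with_oo (push true inf) (push a e).
    by apply/funext => -[].
  split=> [[[a|] fa] [n1 n2]|nn].
  + by apply: n1; exists a; rewrite -Hi -fin.
  (* The 0 is a dummy value: the pattern makes this variable infinite. *)
  + by apply: n2; exists 0; rewrite -Hi' -infi.
  have [[a fa]|n1] := EM (exists a, psat (vf1 S) (push a e) (B i)).
    by exists (Some a); rewrite fin Hi.
  have [[a fa]|n2] := EM (exists a, psat (vf1 S) (push a e) (B' i')).
    by exists None; rewrite (infi a) Hi'.
  by case: nn.
Qed.

End Splitting.

Definition emb (S : vf_data) (c : option int) : sG S := omap (fun m => vf1 S *~ m) c.

Section Omitting.
Variable S : vf_data.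
Hypothesis hchR : [pchar (vfR S)] =i pred0.
Hypothesis hS : ac_valued_field S.
Hypothesis hG : Z_group (vf1 S).
Hypothesis hQE : K_quantifier_elimination (Th S).

Let asg0 (x : sG S) : asg_of S :=
  Asg (fun=> 0 : sK S) (fun=> 0 : sR S) (push x (fun=> Some 0)).

(** The point oo is standard. For finite [x], quantifier elimination and the splitting turn [f] into
    a Presburger formula in one variable, which has a standard solution by [Z_group_definable]. *)
Lemma standard_point f x : ssat (asg0 x) f -> exists c, ssat (asg0 (emb S c)) f.
Proof.
case: x => [x|]; last by exists None.
have [hv [res [hres _]]] := hS.
have [g [qg gQ]] := hQE f; have fg (e : asg_of S) : ssat e f <-> ssat e g.
  exact (gQ S (fun _ Tf => Tf.2) (aK e) (aR e) (aG e)).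
have [I [B HB]] := K_quantifier_free_split hchR hv hres qg (fun=> false).
have [i Hi] := HB (fun=> 0).
have eqv y : ssat (asg0 (Some y)) g <-> psat (vf1 S) (push y (fun=> 0)) (B i).
  rewrite -Hi /ssat /=; suff -> : push (Some y) (fun=> Some 0) =
    with_oo (fun=> false) (push y (fun=> 0)) :> (nat -> sG S) by [].
  by apply/funext => -[].
move=> /fg/eqv/(Z_group_definable hG)[m fm].
by exists (Some m); apply/fg/eqv.
Qed.

(** The projection of [P] to coordinate [i] is defined by a formula in one variable of the
    Gamma-sort, so [standard_point] applies. *)
Lemma omit_nonstandard (P : asg_of S -> Prop) : definable P ->
  forall i, (exists e, P e) -> exists c, exists2 e, P e & aG e i = emb S c.
Proof.
move=> defP i [e Pe]; have [f Hf] := defP.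
have [N0 HN0] := definable_finite defP.
pose N := maxn N0 i.+1.
(* Variable [N] is the first one beyond the block bound by [ex_all N]. Outside the block it is
   variable 0, where [asg0] puts the value under test. *)
have [h Hh] : definable (fun e => P e /\ aG e i = aG e N).
  apply: definable_and => //; exists (FEqG (GVar i) (GVar N)) => e'.
  by rewrite /ssat.
(* Values below [N] come from [e], which is enough for [P]; the others are those of [asg0], moved up
   by [N]. *)
pose cut T (a : nat -> T) (b : nat -> T) j := if (j < N)%N then a j else b (j - N)%N.
have cut_ge T a b j : @cut T a b (N + j)%N = b j.
  by rewrite /cut ltnNge leq_addr addKn.
have : ssat (asg0 (aG e i)) (ex_all N h).
  apply/ssat_ex_all.
  exists (Asg (cut _ (aK e) (aK (asg0 (aG e i)))) (cut _ (aR e) (aR (asg0 (aG e i))))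
              (cut _ (aG e) (aG (asg0 (aG e i))))).
    by move=> j; rewrite /= !cut_ge.
  apply/Hh; split.
    apply: HN0 Pe => j lej; have ltj : (j < N)%N.
      by apply: leq_trans lej _; apply: leq_maxl.
    by rewrite /= /cut ltj.
  rewrite /= -[in RHS](addn0 N) cut_ge /cut.
  by rewrite (leq_maxr N0 i.+1).
case/standard_point => c /ssat_ex_all[e' sh /Hh[Pe' ei]].
exists c, e' => //; rewrite ei; have [_ _] := sh 0%N.
by rewrite addn0.
Qed.

Fixpoint gnum (n : nat) : Gterm := if n is m.+1 then GAdd GOne (gnum m) else GZero.

Lemma Geval_num (eK : nat -> sK S) (eG : nat -> sG S) n :
  Geval eK eG (gnum n) = Some (vf1 S *+ n).
Proof. by elim: n => //= n ->; rewrite mulrS. Qed.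

Definition gis (i : nat) (c : option int) : formula :=
  match c with
  | Some (Posz n) => FEqG (GVar i) (gnum n)
  | Some (Negz n) => FEqG (GAdd (GVar i) (gnum n.+1)) GZero
  | None => FEqG (GVar i) GInf
  end.

Lemma ssat_gis (e : asg_of S) i c : ssat e (gis i c) <-> aG e i = emb S c.
Proof.
rewrite /ssat; case: c => [[n|n]|] //=; rewrite ?Geval_num //= -/(gnum n.+1).
rewrite -mulrS NegzE mulrNz; case: (aG e i) => [x|] //=.
split=> -[/eqP]; first by rewrite addr_eq0 => /eqP->.
by move=> /eqP->; rewrite addNr.
Qed.

Lemma definable_emb i c : definable (fun e : asg_of S => aG e i = emb S c).
Proof. by exists (gis i c) => e; rewrite ssat_gis. Qed.

End Omitting.

(** * The limit of a generic sequence of assignments *)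

Section LimitField.
Variables (F : fieldType) (x : nat -> nat -> F).
Hypothesis x_dec : forall i j,
  ev (fun n => x n i = x n j) \/ ev (fun n => x n i <> x n j).
Variables (zero one : nat) (opp inv : nat -> nat) (add mul : nat -> nat -> nat).
Hypothesis zeroP : ev (fun n => x n zero = 0).
Hypothesis oneP : ev (fun n => x n one = 1).
Hypothesis oppP : forall i, ev (fun n => x n (opp i) = - x n i).
Hypothesis invP : forall i, ev (fun n => x n (inv i) = (x n i)^-1).
Hypothesis addP : forall i j, ev (fun n => x n (add i j) = x n i + x n j).
Hypothesis mulP : forall i j, ev (fun n => x n (mul i j) = x n i * x n j).

(** Elements of the limit are indices modulo eventual equality. The field identities hold there
    because they hold in [F] at all late stages. *)
Let E (i j : nat) : bool := `[< ev (fun n => x n i = x n j) >].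

Let E_refl : reflexive E.
Proof. by move=> i; apply/asboolP; apply: ev_all. Qed.

Let E_sym : symmetric E.
Proof. by move=> i j; apply/asboolP/asboolP; apply: ev_sub => n ->. Qed.

Let E_trans : transitive E.
Proof.
move=> j i k /asboolP ij /asboolP jk; apply/asboolP.
by apply: ev_sub2 ij jk => n ->.
Qed.

Let Equiv := EquivRel E E_refl E_sym E_trans.
Let L := {eq_quot Equiv}%qT.

Let lim (i : nat) : L := (\pi_L i)%qT.

Let lim_eq i j : (lim i = lim j) <-> ev (fun n => x n i = x n j).
Proof.
have h : (lim i == lim j) = E i j := eqmodE Equiv i j.
by split=> [/eqP|e]; [rewrite h => /asboolP | apply/eqP; rewrite h; apply/asboolP].
Qed.

Let lim_repr (a : L) : exists i, a = lim i.
Proof. by exists (repr a); rewrite /lim reprK. Qed.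

Let repr_lim i : ev (fun n => x n (repr (lim i)) = x n i).
Proof. by apply/lim_eq; rewrite /lim reprK. Qed.

Let addL (a b : L) : L := lim (add (repr a) (repr b)).
Let mulL (a b : L) : L := lim (mul (repr a) (repr b)).
Let oppL (a : L) : L := lim (opp (repr a)).
Let invL (a : L) : L := lim (inv (repr a)).

Let addE i j : addL (lim i) (lim j) = lim (add i j).
Proof.
apply/lim_eq; have := ev_and (repr_lim i) (ev_and (repr_lim j)
  (ev_and (addP (repr (lim i)) (repr (lim j))) (addP i j))).
by apply: ev_sub => n [hi [hj [-> ->]]]; rewrite hi hj.
Qed.

Let mulE i j : mulL (lim i) (lim j) = lim (mul i j).
Proof.
apply/lim_eq; have := ev_and (repr_lim i) (ev_and (repr_lim j)
  (ev_and (mulP (repr (lim i)) (repr (lim j))) (mulP i j))).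
by apply: ev_sub => n [hi [hj [-> ->]]]; rewrite hi hj.
Qed.

Let oppE i : oppL (lim i) = lim (opp i).
Proof.
apply/lim_eq; have := ev_and (repr_lim i)
  (ev_and (oppP (repr (lim i))) (oppP i)).
by apply: ev_sub => n [hi [-> ->]]; rewrite hi.
Qed.

Let invE i : invL (lim i) = lim (inv i).
Proof.
apply/lim_eq; have := ev_and (repr_lim i)
  (ev_and (invP (repr (lim i))) (invP i)).
by apply: ev_sub => n [hi [-> ->]]; rewrite hi.
Qed.

Let addA : associative addL.
Proof.
move=> a b c; have [[i ->] [j ->] [k ->]] := And3 (lim_repr a) (lim_repr b) (lim_repr c).
rewrite !addE; apply/lim_eq.
have := ev_and (ev_and (addP j k) (addP i (add j k)))
               (ev_and (addP i j) (addP (add i j) k)).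
by apply: ev_sub => n [[h1 h2] [h3 h4]]; rewrite h2 h1 h4 h3 addrA.
Qed.

Let addC : commutative addL.
Proof.
move=> a b; have [[i ->] [j ->]] := conj (lim_repr a) (lim_repr b).
rewrite !addE; apply/lim_eq.
by apply: ev_sub (ev_and (addP i j) (addP j i)) => n [-> ->]; rewrite addrC.
Qed.

Let add0 : left_id (lim zero) addL.
Proof.
move=> a; have [i ->] := lim_repr a; rewrite addE; apply/lim_eq.
by apply: ev_sub (ev_and (addP zero i) zeroP) => n [-> ->]; rewrite add0r.
Qed.

Let addN : left_inverse (lim zero) oppL addL.
Proof.
move=> a; have [i ->] := lim_repr a; rewrite oppE addE; apply/lim_eq.
have := ev_and (addP (opp i) i) (ev_and (oppP i) zeroP).
by apply: ev_sub => n [-> [-> ->]]; rewrite addNr.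
Qed.

Let mulA : associative mulL.
Proof.
move=> a b c; have [[i ->] [j ->] [k ->]] := And3 (lim_repr a) (lim_repr b) (lim_repr c).
rewrite !mulE; apply/lim_eq.
have := ev_and (ev_and (mulP j k) (mulP i (mul j k)))
               (ev_and (mulP i j) (mulP (mul i j) k)).
by apply: ev_sub => n [[h1 h2] [h3 h4]]; rewrite h2 h1 h4 h3 mulrA.
Qed.

Let mulC : commutative mulL.
Proof.
move=> a b; have [[i ->] [j ->]] := conj (lim_repr a) (lim_repr b).
rewrite !mulE; apply/lim_eq.
by apply: ev_sub (ev_and (mulP i j) (mulP j i)) => n [-> ->]; rewrite mulrC.
Qed.

Let mul1 : left_id (lim one) mulL.
Proof.
move=> a; have [i ->] := lim_repr a; rewrite mulE; apply/lim_eq.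
by apply: ev_sub (ev_and (mulP one i) oneP) => n [-> ->]; rewrite mul1r.
Qed.

Let mulD : left_distributive mulL addL.
Proof.
move=> a b c; have [[i ->] [j ->] [k ->]] := And3 (lim_repr a) (lim_repr b) (lim_repr c).
rewrite addE !mulE addE; apply/lim_eq.
have := ev_and (ev_and (addP i j) (mulP (add i j) k))
  (ev_and (ev_and (mulP i k) (mulP j k)) (addP (mul i k) (mul j k))).
by apply: ev_sub => n [[h1 h2] [[h3 h4] h5]]; rewrite h2 h1 h5 h3 h4 mulrDl.
Qed.

Let one_neq0 : lim one != lim zero.
Proof.
apply/eqP => /lim_eq h; apply: ev_const.
apply: ev_sub (ev_and h (ev_and oneP zeroP)) => n [e [e1 e0]].
by have /eqP := oner_neq0 F; rewrite -e1 e e0.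
Qed.

Let mulV (a : L) : a != lim zero -> mulL (invL a) a = lim one.
Proof.
have [i ->] := lim_repr a; rewrite invE mulE => /eqP ni0; apply/lim_eq.
(* By [x_dec], an index outside the class of [zero] has nonzero values from some stage on. *)
have [/lim_eq//|nx0] := x_dec i zero.
have := ev_and (ev_and (mulP (inv i) i) (invP i)) (ev_and nx0 (ev_and oneP zeroP)).
apply: ev_sub => n [[-> ->] [/eqP h [-> z]]]; apply: mulVf.
by rewrite -z.
Qed.

Let inv0 : invL (lim zero) = lim zero.
Proof.
rewrite invE; apply/lim_eq.
by apply: ev_sub (ev_and (invP zero) zeroP) => n [-> ->]; rewrite invr0.
Qed.

HB.instance Definition _ := Choice.on L.
HB.instance Definition _ := GRing.isZmodule.Build L addA addC add0 addN.
HB.instance Definition _ :=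
  GRing.Zmodule_isComNzRing.Build L mulA mulC mul1 mulD one_neq0.
HB.instance Definition _ := GRing.ComNzRing_isField.Build L mulV inv0.

Lemma limit_field : exists (L : fieldType) (lim : nat -> L),
  [/\ forall a, exists i, a = lim i,
      forall i j, lim i = lim j <-> ev (fun n => x n i = x n j),
      0 = lim zero /\ 1 = lim one,
      forall i j, lim i + lim j = lim (add i j) /\ lim i * lim j = lim (mul i j)
    & forall i, - lim i = lim (opp i)].
Proof.
by exists L, lim; split.
Qed.

End LimitField.

(** An interface that hides the quotient: [cv u a] says that the sequence [u] has limit [a]. It
    speaks of sequences instead of indices so that values of terms along the assignments can be
    handled directly. *)
Record limits (F : fieldType) (x : nat -> nat -> F) (L : fieldType)
    (cv : (nat -> F) -> L -> Prop) : Prop := Limits {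
  cv_surj : forall a, exists i, cv (fun n => x n i) a;
  cv_ex : forall i, exists a, cv (fun n => x n i) a;
  cv_ev : forall u w a, ev (fun n => u n = w n) -> cv u a -> cv w a;
  cv_eq : forall u w a b, cv u a -> cv w b -> (a = b <-> ev (fun n => u n = w n));
  cv_neq : forall u w a b, cv u a -> cv w b -> a <> b -> ev (fun n => u n <> w n);
  cv0 : cv (fun=> 0) 0;
  cv1 : cv (fun=> 1) 1;
  cvD : forall u w a b, cv u a -> cv w b -> cv (fun n => u n + w n) (a + b);
  cvB : forall u w a b, cv u a -> cv w b -> cv (fun n => u n - w n) (a - b);
  cvM : forall u w a b, cv u a -> cv w b -> cv (fun n => u n * w n) (a * b)
}.

Lemma limits_exist (F : fieldType) (x : nat -> nat -> F) :
  (forall i j, ev (fun n => x n i = x n j) \/ ev (fun n => x n i <> x n j)) ->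
  (exists i, ev (fun n => x n i = 0)) ->
  (exists i, ev (fun n => x n i = 1)) ->
  (forall i, exists j, ev (fun n => x n j = - x n i)) ->
  (forall i, exists j, ev (fun n => x n j = (x n i)^-1)) ->
  (forall i j, exists k, ev (fun n => x n k = x n i + x n j)) ->
  (forall i j, exists k, ev (fun n => x n k = x n i * x n j)) ->
  exists (L : fieldType) (cv : (nat -> F) -> L -> Prop), limits x cv.
Proof.
move=> dec [zero zeroP] [one oneP] /choice[opp oppP] /choice[inv invP] hadd hmul.
have /choice[add addP] (p : nat * nat) :
  exists k, ev (fun n => x n k = x n p.1 + x n p.2) by apply: hadd.
have /choice[mul mulP] (p : nat * nat) :
  exists k, ev (fun n => x n k = x n p.1 * x n p.2) by apply: hmul.
have [L [lim [surj eqP [e0 e1] eDM eN]]] := limit_field dec zeroP oneP oppP invP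
  (fun i j => addP (i, j)) (fun i j => mulP (i, j)).
exists L, (fun u a => exists2 i, a = lim i & ev (fun n => x n i = u n)); split.
- by move=> a; have [i ->] := surj a; exists i, i => //; apply: ev_all.
- by move=> i; exists (lim i), i => //; apply: ev_all.
- by move=> u w a uw [i -> iu]; exists i => //; apply: ev_sub2 iu uw => n ->.
- move=> u w a b [i -> iu] [j -> jw]; rewrite eqP; split=> h.
    by apply: ev_sub2 h (ev_and iu jw) => n h [<- <-].
  by apply: ev_sub2 h (ev_and iu jw) => n h [-> ->].
- move=> u w a b [i -> iu] [j -> jw] nij.
  have [/eqP//|h] := dec i j.
  by apply: ev_sub2 h (ev_and iu jw) => n h [<- <-].
- by exists zero; rewrite ?e0.
- by exists one; rewrite ?e1.
- move=> u w a b [i -> iu] [j -> jw]; have [-> _] := eDM i j.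
  exists (add (i, j)) => //.
  by apply: ev_sub2 (addP (i, j)) (ev_and iu jw) => n -> [-> ->].
- move=> u w a b [i -> iu] [j -> jw]; rewrite eN; have [-> _] := eDM i (opp j).
  exists (add (i, opp j)) => //.
  by apply: ev_sub2 (addP (i, opp j)) (ev_and (oppP j) (ev_and iu jw))
    => n -> /= [-> [-> ->]].
- move=> u w a b [i -> iu] [j -> jw]; have [_ ->] := eDM i j.
  exists (mul (i, j)) => //.
  by apply: ev_sub2 (mulP (i, j)) (ev_and iu jw) => n -> [-> ->].
Qed.

(** * The order embedding of Z with oo into the Gamma-sort *)

Section Embedding.
Variable S : vf_data.
Hypothesis hG : Z_group (vf1 S).

Lemma emb_inj : injective (emb S).
Proof. by move=> [m|] [n|] //= -[/(Z_group_inj hG)->]. Qed.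

Lemma embD a b : emb S (add_oo a b) = add_oo (emb S a) (emb S b).
Proof. by case: a b => [m|] [n|] //=; rewrite mulrzDr. Qed.

Lemma emb_lt a b : lt_oo (emb S a) (emb S b) = lt_oo a b.
Proof. by case: a b => [m|] [n|] //=; rewrite Z_group_lt. Qed.

Lemma emb_le a b : le_oo (emb S a) (emb S b) = le_oo a b.
Proof.
case: a b => [m|] [n|] //=.
by rewrite !le_eqVlt Z_group_lt // (inj_eq (Z_group_inj hG)).
Qed.

Lemma emb_min a b : emb S (min_oo a b) = min_oo (emb S a) (emb S b).
Proof. by rewrite /min_oo emb_lt; case: ifP. Qed.

Lemma emb_div n a : div_oo n.+2 (emb S a) <-> div_oo n.+2 a.
Proof. by case: a => [m|] //=; apply: Z_group_div. Qed.

End Embedding.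

(** * The limit structure and its valued field axioms *)

Section Assembly.
Variables (S : vf_data) (res : vfK S -> vfR S).
Hypothesis hG : Z_group (vf1 S).
Hypotheses (hv : is_valuation (@vfv S)) (hres : is_residue_map (@vfv S) res).
Hypothesis hac : is_angular_component (@vfv S) res (@vfac S).
Variable e : nat -> asg_of S.
Hypothesis e_dec : forall f s, ev (fun n => ssat (pull (e n) s) f) \/
                               ev (fun n => ~ ssat (pull (e n) s) f).
Hypothesis e_exK : forall f s, ev (fun n => ssat (pull (e n) s) (FExK f)) ->
  exists j, ev (fun n => ssat (pull (e n) (pushK j s)) f).
Hypothesis e_exR : forall f s, ev (fun n => ssat (pull (e n) s) (FExR f)) ->
  exists j, ev (fun n => ssat (pull (e n) (pushR j s)) f).
Hypothesis e_exG : forall f s, ev (fun n => ssat (pull (e n) s) (FExG f)) ->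
  exists j, ev (fun n => ssat (pull (e n) (pushG j s)) f).
Hypothesis e_std : forall i, exists c, ev (fun n => aG (e n) i = emb S c).

Let xK n i : vfK S := aK (e n) i.
Let xR n i : vfR S := aR (e n) i.

(* These equations characterize x^-1 including the convention 0^-1 = 0. *)
Let pseudo_inverse (F : fieldType) (x y : F) :
  x = x * (x * y) /\ y = y * (y * x) -> y = x^-1.
Proof.
case=> h1 h2; have [x0|nx0] := eqVneq x 0.
  by move: h2; rewrite x0 !mulr0 invr0.
by apply: (mulfI nx0); rewrite divff //; apply: (mulfI nx0); rewrite mulr1.
Qed.

Let pseudo_inverse_ex (F : fieldType) (x : F) :
  exists y, x = x * (x * y) /\ y = y * (y * x).
Proof.
exists x^-1; have [->|nx0] := eqVneq x 0; first by rewrite invr0 !mulr0.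
by rewrite divff // mulVf // !mulr1.
Qed.

(** Constants and results of operations on variables are again named by variables, as witnesses of
    existential formulas true at every stage. *)
Lemma K_limits :
  exists (L : fieldType) (cv : (nat -> vfK S) -> L -> Prop), limits xK cv.
Proof.
have ex f (s : seq nat) : (forall e : asg_of S,
    ssat (pull e (ren_of (s, [::], [::]))) (FExK f)) ->
    exists k, ev (fun n => ssat (pull (e n) (pushK k (ren_of (s, [::], [::])))) f).
  by move=> h; apply: e_exK; apply: ev_all.
apply: limits_exist.
- by move=> i j; apply: (e_dec (FEqK (KVar 0) (KVar 1)) (ren_of ([:: i; j], [::], [::]))).
- by apply: (ex (FEqK (KVar 0) KZero) [::]) => a; exists (0 : vfK S).
- by apply: (ex (FEqK (KVar 0) KOne) [::]) => a; exists (1 : vfK S).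
- move=> i; have [j Hj] : exists j, ev (fun n => xK n j = 0 - xK n i).
    apply: (ex (FEqK (KVar 0) (KSub KZero (KVar 1))) [:: i]) => a.
    by exists (0 - aK a i : vfK S).
  by exists j; apply: ev_sub Hj => n ->; rewrite sub0r.
- move=> i; have [j Hj] := ex
    (FAnd (FEqK (KVar 1) (KMul (KVar 1) (KMul (KVar 1) (KVar 0))))
          (FEqK (KVar 0) (KMul (KVar 0) (KMul (KVar 0) (KVar 1))))) [:: i]
    (fun a => pseudo_inverse_ex (aK a i : vfK S)).
  by exists j; apply: ev_sub Hj => n; apply: pseudo_inverse.
- move=> i j.
  apply: (ex (FEqK (KVar 0) (KAdd (KVar 1) (KVar 2))) [:: i; j]) => a.
  by exists (aK a i + aK a j : vfK S).
- move=> i j.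
  apply: (ex (FEqK (KVar 0) (KMul (KVar 1) (KVar 2))) [:: i; j]) => a.
  by exists (aK a i * aK a j : vfK S).
Qed.

Lemma R_limits :
  exists (L : fieldType) (cv : (nat -> vfR S) -> L -> Prop), limits xR cv.
Proof.
have ex f (s : seq nat) : (forall e : asg_of S,
    ssat (pull e (ren_of ([::], s, [::]))) (FExR f)) ->
    exists k, ev (fun n => ssat (pull (e n) (pushR k (ren_of ([::], s, [::])))) f).
  by move=> h; apply: e_exR; apply: ev_all.
apply: limits_exist.
- by move=> i j; apply: (e_dec (FEqR (RVar 0) (RVar 1)) (ren_of ([::], [:: i; j], [::]))).
- by apply: (ex (FEqR (RVar 0) RZero) [::]) => a; exists (0 : vfR S).
- by apply: (ex (FEqR (RVar 0) ROne) [::]) => a; exists (1 : vfR S).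
- move=> i; have [j Hj] : exists j, ev (fun n => xR n j = 0 - xR n i).
    apply: (ex (FEqR (RVar 0) (RSub RZero (RVar 1))) [:: i]) => a.
    by exists (0 - aR a i : vfR S).
  by exists j; apply: ev_sub Hj => n ->; rewrite sub0r.
- move=> i; have [j Hj] := ex
    (FAnd (FEqR (RVar 1) (RMul (RVar 1) (RMul (RVar 1) (RVar 0))))
          (FEqR (RVar 0) (RMul (RVar 0) (RMul (RVar 0) (RVar 1))))) [:: i]
    (fun a => pseudo_inverse_ex (aR a i : vfR S)).
  by exists j; apply: ev_sub Hj => n; apply: pseudo_inverse.
- move=> i j.
  apply: (ex (FEqR (RVar 0) (RAdd (RVar 1) (RVar 2))) [:: i; j]) => a.
  by exists (aR a i + aR a j : vfR S).
- move=> i j.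
  apply: (ex (FEqR (RVar 0) (RMul (RVar 1) (RVar 2))) [:: i; j]) => a.
  by exists (aR a i * aR a j : vfR S).
Qed.

(** A standard element is definable, so its defining formula has a variable as witness. *)
Lemma G_surj c : exists i, ev (fun n => aG (e n) i = emb S c).
Proof.
have [j Hj] : exists j, ev (fun n => ssat (pull (e n)
    (pushG j (ren_of ([::], [::], [::])))) (gis 0 c)).
  apply: e_exG; apply: ev_all => n; exists (emb S c).
  by apply/(ssat_gis (Asg _ _ (push (emb S c) _))).
by exists j; apply: ev_sub Hj => n /ssat_gis.
Qed.

Variables (K1 R1 : fieldType).
Variables (cvK : (nat -> vfK S) -> K1 -> Prop) (cvR : (nat -> vfR S) -> R1 -> Prop).
Hypotheses (limK : limits xK cvK) (limR : limits xR cvR).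

(** The value of a K-variable is named by a variable of the Gamma-sort, which [e_std] makes
    eventually equal to one standard element. Here the omission of the type yields values in Z. *)
Lemma v1_exists : exists v1 : K1 -> option int, forall u a,
  cvK u a -> ev (fun n => vfv (u n) = emb S (v1 a)).
Proof.
suff /choice[v1 v1P] (a : K1) : exists c, forall u,
    cvK u a -> ev (fun n => vfv (u n) = emb S c).
  by exists v1 => u a; apply: v1P.
have [i ia] := cv_surj limK a.
have [j Hj] : exists j, ev (fun n => aG (e n) j = vfv (xK n i)).
  apply: (@e_exG (FEqG (GVar 0) (GVal (KVar 0))) (ren_of ([:: i], [::], [::]))).
  by apply: ev_all => n; exists (vfv (xK n i)).
have [c Hc] := e_std j; exists c => u ua.
have /(cv_eq limK ia ua) iu : a = a by [].
by apply: ev_sub2 iu (ev_and Hj Hc) => n <- [<- ->].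
Qed.

Lemma ac1_exists : exists ac1 : K1 -> R1, forall u a,
  cvK u a -> cvR (fun n => vfac (u n)) (ac1 a).
Proof.
suff /choice[ac1 ac1P] (a : K1) : exists b, forall u,
    cvK u a -> cvR (fun n => vfac (u n)) b.
  by exists ac1 => u a; apply: ac1P.
have [i ia] := cv_surj limK a.
have [j Hj] : exists j, ev (fun n => xR n j = vfac (xK n i)).
  apply: (@e_exR (FEqR (RVar 0) (RAc (KVar 0))) (ren_of ([:: i], [::], [::]))).
  by apply: ev_all => n; exists (vfac (xK n i)).
have [b jb] := cv_ex limR j; exists b => u ua.
have /(cv_eq limK ia ua) iu : a = a by [].
by apply: cv_ev limR _ _ _ _ jb; apply: ev_sub2 iu Hj => n <-.
Qed.

Variables (v1 : K1 -> option int) (ac1 : K1 -> R1).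
Hypothesis v1P : forall u a, cvK u a -> ev (fun n => vfv (u n) = emb S (v1 a)).
Hypothesis ac1P : forall u a, cvK u a -> cvR (fun n => vfac (u n)) (ac1 a).

Let approx (a : K1) : exists u, cvK u a.
Proof. by have [i ia] := cv_surj limK a; exists (xK^~ i). Qed.

(** Each axiom holds at late stages and is pulled back along [emb], which is injective and respects
    addition and order. *)
Lemma v1_valuation : is_valuation v1.
Proof.
case: (hv) => _ v_0 v_M v_D v_surj; split.
- by split=> [x y|x y z]; [apply: le_total | rewrite lerD2r].
- move=> a; have [u ua] := approx a; rewrite (cv_eq limK ua (cv0 limK)); split=> h.
    by apply: ev_sub (v1P ua) => n; rewrite h => /v_0.
  apply: (emb_inj hG); apply: ev_const; apply: ev_sub2 h (v1P ua) => n.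
  by move=> /v_0-> <-.
- move=> a b; have [[u ua] [w wb]] := conj (approx a) (approx b).
  apply: (emb_inj hG); apply: ev_const.
  apply: ev_sub2 (v1P (cvM limK ua wb)) (ev_and (v1P ua) (v1P wb)) => n.
  by rewrite embD => <- [<- <-].
- move=> a b; have [[u ua] [w wb]] := conj (approx a) (approx b).
  apply: ev_const.
  apply: ev_sub2 (v1P (cvD limK ua wb)) (ev_and (v1P ua) (v1P wb)) => n.
  rewrite -(emb_le hG) emb_min // => <- [<- <-]; exact: v_D.
- move=> m; have [j Hj] := G_surj (Some m).
  (* That the value of variable [j] is attained is an existential formula, true because [v] is
     onto. *)
  have [i Hi] : exists i, ev (fun n => vfv (xK n i) = aG (e n) j).
    apply: (@e_exK (FEqG (GVal (KVar 0)) (GVar 0)) (ren_of ([::], [::], [:: j]))).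
    apply: ev_sub Hj => n Hj; have [x vx] := v_surj (vf1 S *~ m).
    by exists x; rewrite /= vx Hj.
  have [a ia] := cv_ex limK i; exists a.
  apply: (emb_inj hG); apply: ev_const.
  by apply: ev_sub2 (v1P ia) (ev_and Hi Hj) => n <- [-> ->].
Qed.

(** The residue map is not a symbol of the language, so it is rebuilt from [ac1]: it agrees with
    [ac1] on units and vanishes on the maximal ideal. *)
Let res1 (a : K1) : R1 := if v1 a == Some 0 then ac1 a else 0.

Let res1P u a : cvK u a -> le_oo (Some 0) (v1 a) -> cvR (fun n => res (u n)) (res1 a).
Proof.
case: hac => _ _ _ ac_unit; case: (hres) => _ _ _ res_M _.
move=> ua Oa; rewrite /res1; case: eqP => va.
  apply: cv_ev limR _ _ _ _ (ac1P ua); apply: ev_sub (v1P ua) => n.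
  by rewrite va /= mulr0z => /ac_unit.
apply: cv_ev limR _ _ _ _ (cv0 limR); apply: ev_sub (v1P ua) => n vu.
have M : lt_oo (Some 0) (vfv (u n)).
  rewrite vu -[Some 0]/(Some (0 : vfG S)) -(mulr0z (vf1 S)).
  rewrite -[Some _]/(emb S (Some 0)) emb_lt //.
  move: Oa va; case: (v1 a) => //= m; rewrite le_eqVlt => /orP[/eqP<-|//].
  by case.
by apply/esym/res_M => //; move: M; case: (vfv _) => //= g /ltW.
Qed.

Let v1_le0 u a : cvK u a ->
  ev (fun n => le_oo (Some 0) (vfv (u n)) = le_oo (Some 0) (v1 a)).
Proof.
move=> ua; apply: ev_sub (v1P ua) => n ->.
by rewrite -(emb_le hG) /= mulr0z.
Qed.

Let v1_lt0 u a : cvK u a ->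
  ev (fun n => lt_oo (Some 0) (vfv (u n)) = lt_oo (Some 0) (v1 a)).
Proof.
move=> ua; apply: ev_sub (v1P ua) => n ->.
by rewrite -(emb_lt hG) /= mulr0z.
Qed.

Lemma res1_residue_map : is_residue_map v1 res1.
Proof.
case: (hres) => res_1 res_D res_M res_0 res_surj.
have O (a : K1) u : cvK u a -> le_oo (Some 0) (v1 a) ->
    ev (fun n => le_oo (Some 0) (vfv (u n))).
  by move=> ua Oa; apply: ev_sub (v1_le0 ua) => n ->.
have O' (a : K1) u : cvK u a -> ev (fun n => le_oo (Some 0) (vfv (u n))) ->
    le_oo (Some 0) (v1 a).
  by move=> ua Ou; apply: ev_const; apply: ev_sub2 Ou (v1_le0 ua) => n + <-.
have le_trans0 (G : porderZmodType) (x y z : option G) :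
    le_oo (Some 0) x -> le_oo (Some 0) y -> le_oo (min_oo x y) z -> le_oo (Some 0) z.
  by rewrite /min_oo; case: ifP => _; case: x y z => [x|] [y|] [z|] //= ? ?;
    apply: le_trans.
have O1 : le_oo (Some 0) (v1 1).
  by apply: O' (cv1 limK) _; apply: ev_all => n; rewrite (valuation1 hv) /=.
split.
- apply/(cv_eq limR (res1P (cv1 limK) O1) (cv1 limR)).
  by apply: ev_all => n.
- move=> a b Oa Ob; have [[u ua] [w wb]] := conj (approx a) (approx b).
  have Oab : le_oo (Some 0) (v1 (a + b)).
    by case: v1_valuation => _ _ _ /(_ a b) + _; apply: le_trans0.
  apply/(cv_eq limR (res1P (cvD limK ua wb) Oab) (cvD limR (res1P ua Oa) (res1P wb Ob))).
  by apply: ev_sub2 (O _ _ ua Oa) (O _ _ wb Ob) => n; apply: res_D.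
- move=> a b Oa Ob; have [[u ua] [w wb]] := conj (approx a) (approx b).
  have Oab : le_oo (Some 0) (v1 (a * b)).
    case: v1_valuation => _ _ -> _ _.
    by move: Oa Ob; case: (v1 a) (v1 b) => [x|] [y|] //=; apply: addr_ge0.
  apply/(cv_eq limR (res1P (cvM limK ua wb) Oab) (cvM limR (res1P ua Oa) (res1P wb Ob))).
  by apply: ev_sub2 (O _ _ ua Oa) (O _ _ wb Ob) => n; apply: res_M.
- move=> a Oa; have [u ua] := approx a.
  rewrite (cv_eq limR (res1P ua Oa) (cv0 limR)); split=> h.
    apply: ev_const; apply: ev_sub2 (v1_lt0 ua) (ev_and h (O _ _ ua Oa)) => n.
    by move=> <- [r0 On]; apply/res_0.
  apply: ev_sub2 (v1_lt0 ua) (O _ _ ua Oa) => n + On.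
  by rewrite h => M; apply/res_0.
(* Witnesses exist only for formulas of the language, so a nonzero [b] is lifted to a unit with
   angular component [b], and [b = 0] to 0. *)
move=> b; have [b0|/eqP nb0] := eqVneq b 0.
  exists 0; case: v1_valuation => _ /(_ 0)[_ /(_ erefl) v10] _ _ _.
  by rewrite /res1 v10 /= b0.
have [j jb] := cv_surj limR b.
have [i Hi] : exists i, ev (fun n => vfv (xK n i) = Some 0 /\ vfac (xK n i) = xR n j).
  apply: (@e_exK (FAnd (FEqG (GVal (KVar 0)) GZero) (FEqR (RAc (KVar 0)) (RVar 0)))
    (ren_of ([::], [:: j], [::]))).
  (* Where [xR n j] is nonzero, any integral element with this residue is a unit, so its angular
     component is the residue. *)
  apply: ev_sub (cv_neq limR jb (cv0 limR) nb0) => n /eqP rn0.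
  have [x [Ox rx]] := res_surj (xR n j).
  have vx : vfv x = Some 0 by apply: val_unit hres _ Ox _; rewrite rx.
  exists x; split=> //=; rewrite -/(xR n j) -rx.
  by case: hac => _ _ _; apply.
have [a ia] := cv_ex limK i; exists a.
have va : v1 a = Some 0.
  apply: (emb_inj hG); apply: ev_const; apply: ev_sub2 (v1P ia) Hi => n <- [-> _].
  by rewrite /= mulr0z.
split; first by rewrite va /=.
rewrite /res1 va eqxx; apply/(cv_eq limR (ac1P ia) jb).
by apply: ev_sub Hi => n [].
Qed.

Lemma ac1_angular_component : is_angular_component v1 res1 ac1.
Proof.
case: (hac) => ac_0 ac_n0 ac_M _; split.
- by apply/(cv_eq limR (ac1P (cv0 limK)) (cv0 limR)); apply: ev_all.
- move=> a /eqP na0; have [u ua] := approx a; apply/eqP.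
  move=> /(cv_eq limR (ac1P ua) (cv0 limR)) h; apply: ev_const.
  apply: ev_sub2 h (cv_neq limK ua (cv0 limK) na0) => n + /eqP /ac_n0 /eqP.
  by move=> ->.
- move=> a b /eqP na0 /eqP nb0.
  have [[u ua] [w wb]] := conj (approx a) (approx b).
  apply/(cv_eq limR (ac1P (cvM limK ua wb)) (cvM limR (ac1P ua) (ac1P wb))).
  apply: ev_sub2 (cv_neq limK ua (cv0 limK) na0) (cv_neq limK wb (cv0 limK) nb0) => n.
  by move=> /eqP u0 /eqP w0; apply: ac_M.
- by move=> a va; rewrite /res1 va eqxx.
Qed.

Definition limit_vf : vf_data := @VFData K1 R1 int 1 v1 ac1.

Lemma limit_vf_ac_valued : ac_valued_field limit_vf.
Proof.
split; first exact: v1_valuation.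
exists res1; split; [exact: res1_residue_map | exact: ac1_angular_component].
Qed.

(** A nonzero convex subgroup of Z contains some positive [g], then 1 because [0 <= 1 <= g], and so
    every integer. *)
Lemma limit_vf_rank_one : rank_one limit_vf.
Proof.
split; first by exists (1 : int).
move=> A [A0 AB Aconv].
have AN (m : int) : A m -> A (- m) by rewrite -sub0r; apply: AB.
have AD (m n : int) : A m -> A n -> A (m + n).
  by move=> Am /AN An; rewrite -[n]opprK; apply: AB.
have [[g [Ag g0]]|none] := EM (exists g : int, A g /\ g != 0); last first.
  left=> g; split=> [Ag|->//]; apply/eqP; apply: contrapT => /negP ng.
  by apply: none; exists g.
have {g g0 Ag}[g [Ag g0]] : exists g : int, A g /\ 0 < g.
  have [lt|le] := ltP 0 g; first by exists g.
  by exists (- g); split; [apply: AN | rewrite oppr_gt0 lt_neqAle g0].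
have A1 : A (1 : int) by apply: (Aconv 0 1 g) => //; rewrite ler01 -gtz0_ge1.
have Anat (n : nat) : A (n%:Z) by elim: n => // n An; rewrite -addn1 PoszD; apply: AD.
by right=> -[n|n]; rewrite ?NegzE; [|apply: AN]; apply: Anat.
Qed.

(** * Truth in the limit as eventual truth *)

Section Truth.
Variables (LK : nat -> K1) (LR : nat -> R1) (LG : nat -> option int).
Hypothesis LKP : forall i, cvK (fun n => xK n i) (LK i).
Hypothesis LRP : forall i, cvR (fun n => xR n i) (LR i).
Hypothesis LGP : forall i, ev (fun n => aG (e n) i = emb S (LG i)).

Lemma Keval_limit s t :
  cvK (fun n => Keval (M := S) (xK n \o s) t) (Keval (M := limit_vf) (LK \o s) t).
Proof.
elim: t => /= [i|||t IHt u IHu|t IHt u IHu|t IHt u IHu].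
- exact: LKP.
- exact: cv0 limK.
- exact: cv1 limK.
- exact (cvD limK IHt IHu).
- exact (cvB limK IHt IHu).
- exact (cvM limK IHt IHu).
Qed.

Lemma Reval_limit s r t :
  cvR (fun n => Reval (M := S) (xK n \o s) (xR n \o r) t)
      (Reval (M := limit_vf) (LK \o s) (LR \o r) t).
Proof.
elim: t => /= [i|||t IHt u IHu|t IHt u IHu|t IHt u IHu|t].
- exact: LRP.
- exact: cv0 limR.
- exact: cv1 limR.
- exact (cvD limR IHt IHu).
- exact (cvB limR IHt IHu).
- exact (cvM limR IHt IHu).
- exact (ac1P (Keval_limit s t)).
Qed.

Lemma Geval_limit s g t :
  ev (fun n => Geval (M := S) (xK n \o s) (aG (e n) \o g) t =
      emb S (Geval (M := limit_vf) (LK \o s) (LG \o g) t)).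
Proof.
elim: t => /= [i||||t IHt u IHu|t].
- exact: LGP.
- by apply: ev_all => n; rewrite /emb /= mulr0z.
- by apply: ev_all.
- by apply: ev_all.
- by apply: ev_sub2 IHt IHu => n -> ->; rewrite embD.
- exact (v1P (Keval_limit s t)).
Qed.

(** An analogue of the theorem of Los, with [e_dec] for negation and the witness hypotheses for
    quantifiers. The general renaming [s] lets the induction pass under a quantifier, where the
    bound variable is sent to a variable. *)
Lemma truth f s :
  sat (M := limit_vf) (LK \o aK s) (LR \o aR s) (LG \o aG s) f <->
  ev (fun n => ssat (pull (e n) s) f).
Proof.
elim: f s => [t u|t u|t u|t u|n t|f IH|f IHf h IHh|f IH|f IH|f IH] s.
- exact (cv_eq limK (Keval_limit _ t) (Keval_limit _ u)).
- exact (cv_eq limR (Reval_limit _ _ t) (Reval_limit _ _ u)).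
- have tu := ev_and (Geval_limit (aK s) (aG s) t) (Geval_limit (aK s) (aG s) u).
  split=> /= h; first by apply: ev_sub tu => n [Ht Hu]; rewrite /ssat /= Ht Hu h.
  apply: (emb_inj hG); apply: ev_const; apply: ev_sub2 h tu => n + [<- <-]; exact.
- have tu := ev_and (Geval_limit (aK s) (aG s) t) (Geval_limit (aK s) (aG s) u).
  split=> /= h; first by apply: ev_sub tu => n [Ht Hu]; rewrite /ssat /= Ht Hu emb_lt.
  by apply: ev_const; apply: ev_sub2 h tu => n + [Ht Hu]; rewrite /ssat /= Ht Hu emb_lt.
- have Ht := Geval_limit (aK s) (aG s) t.
  split=> /= h; first by apply: ev_sub Ht => k Ht; rewrite /ssat /= Ht emb_div.
  by apply: ev_const; apply: ev_sub2 h Ht => k + Ht; rewrite /ssat /= Ht emb_div.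
- rewrite /= IH; split=> [nf|nf fe]; first by case: (e_dec f s).
  by apply: ev_const; apply: ev_sub2 nf fe.
- rewrite /= IHf IHh; split=> [[]|fh]; first exact: ev_and.
  by split; apply: ev_sub fh => n [].
- split=> [[a]|/e_exK[j fj]]; last first.
    by exists (LK j); move: fj => /(IH (pushK j s)); rewrite /= push_comp.
  (* Every element of the limit is the limit of a variable, so the quantifier ranges over
     variables. *)
  have [i ia] := cv_surj limK a; have -> : a = LK i.
    by apply/(cv_eq limK ia (LKP i)); apply: ev_all.
  rewrite -push_comp => /(IH (pushK i s)).
  by apply: ev_sub => n; rewrite pull_pushK; exists (xK n i).
- split=> [[a]|/e_exR[j fj]]; last first.
    by exists (LR j); move: fj => /(IH (pushR j s)); rewrite /= push_comp.
  have [i ia] := cv_surj limR a; have -> : a = LR i.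
    by apply/(cv_eq limR ia (LRP i)); apply: ev_all.
  rewrite -push_comp => /(IH (pushR i s)).
  by apply: ev_sub => n; rewrite pull_pushR; exists (xR n i).
- split=> [[a]|/e_exG[j fj]]; last first.
    by exists (LG j); move: fj => /(IH (pushG j s)); rewrite /= push_comp.
  have [i ia] := G_surj a; have -> : a = LG i.
    apply: (emb_inj hG); apply: ev_const.
    by apply: ev_sub2 ia (LGP i) => n <-.
  rewrite -push_comp => /(IH (pushG i s)).
  by apply: ev_sub => n; rewrite pull_pushG; exists (aG (e n) i).
Qed.

End Truth.

(** The truth of a sentence is independent of the assignment, so eventual truth along [e] is truth
    in [S]. *)
Lemma limit_vf_equiv : elem_equiv limit_vf S.
Proof.
have /choice[LK LKP] := cv_ex limK; have /choice[LR LRP] := cv_ex limR.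
have /choice[LG LGP] := e_std.
move=> f sf; have tr := truth LKP LRP LGP f (Asg id id id).
have indep (M : structure) (a b : asg_of M) : ssat a f <-> ssat b f.
  exact: sat_agree sf _ _ _.
split=> h eK eR eG.
  have /tr[N /(_ N (leqnn N)) sN] := h LK LR LG.
  exact ((indep S _ (Asg eK eR eG)).1 sN).
apply ((indep limit_vf (Asg LK LR LG) (Asg eK eR eG)).1).
by apply/tr; apply: ev_all => n; apply: h.
Qed.

End Assembly.

Unset Implicit Arguments.

Theorem theorem5p9 (S : vf_data)
    (hchK : [pchar (vfK S)]%R =i pred0)
    (hchR : [pchar (vfR S)]%R =i pred0)
    (hS : ac_valued_field S)
    (hG : Z_group (vf1 S))
    (hQE : K_quantifier_elimination (Th S)) :
  exists S1 : vf_data,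
    [/\ elem_equiv S1 S, ac_valued_field S1 & rank_one S1].
Proof.
have [hv [res [hres hac]]] := hS.
have [e [dec exK exR exG std]] := generic_assignments (@definable_emb S)
  (omit_nonstandard hchR hS hG hQE).
have [K1 [cvK limK]] := K_limits dec exK.
have [R1 [cvR limR]] := R_limits dec exR.
have [v1 v1P] := v1_exists exG std limK.
have [ac1 ac1P] := ac1_exists exR limK limR.
exists (limit_vf v1 ac1); split.
- exact: (limit_vf_equiv hG dec exK exR exG std limK limR v1P ac1P).
- exact: (limit_vf_ac_valued hG hv hres hac exK exG limK limR v1P ac1P).
- exact: limit_vf_rank_one.
Qed.
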